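(* Let $n\ge 1$ be an integer and $\lambda,\lambda_1,\beta>0$. Let $G_N^{(n)}$ be a compound Poisson-Erlang process with parameters $\lambda,n,\beta$, let $Y^{(n)}(t)=\inf\{u\ge0:G_N^{(n)}(u)>t\}$, $t\ge0$, be its inverse process, and let $N_1$ be a Poisson process with intensity $\lambda_1$ independent of $Y^{(n)}$. Put $Z^{(n)}(t)=N_1(Y^{(n)}(t))$. Then the probability mass function of $Z^{(n)}(t)$ is given by $$P(Z^{(n)}(t)=k)=e^{-\beta t}\,\frac{\lambda\lambda_1^{k}(k+1)}{(\lambda_1+\lambda)^{k+1}}\sum_{m=1}^{n}(\beta t)^{m-1}\,\mathcal{E}_{n,m}^{k+1}\left(\frac{\lambda(\beta t)^{n}}{\lambda_1+\lambda}\right),\qquad k=0,1,2,\ldots,$$ and the Laplace transform is given by $$\mathsf{E}\left[e^{-\theta Z^{(n)}(t)}\right]=e^{-\beta t}\,\frac{\lambda}{\lambda+\lambda_1(1-e^{-\theta})}\sum_{k=1}^{n}(\beta t)^{k-1}\,\mathcal{E}_{n,k}\left(\frac{\lambda(\beta t)^{n}}{\lambda+\lambda_1(1-e^{-\theta})}\right).$$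
   Context: The compound Poisson-Erlang process with parameters $\lambda,n,\beta$ is $G_N^{(n)}(t)=\sum_{j=1}^{N(t)}G_j$, where $N$ is a Poisson process with intensity $\lambda$ and $G_j$ are i.i.d. Gamma random variables with integer shape $n$ and rate $\beta$, independent of $N$ (empty sum $=0$). Generalized Mittag-Leffler functions: $\mathcal{E}_{\rho,\delta}(z)=\sum_{j=0}^{\infty}\frac{z^{j}}{\Gamma(\rho j+\delta)}$ and $\mathcal{E}_{\rho,\delta}^{\gamma}(z)=\sum_{j=0}^{\infty}\frac{\Gamma(\gamma+j)}{\Gamma(\gamma)}\frac{z^{j}}{j!\,\Gamma(\rho j+\delta)}$.
   Formalization: The factor (k+1) in the probability mass function is removed: as printed the formula is false for k≥1 (at t=0 the values would sum to (λ+λ1)/λ>1). The Laplace transform is stated for θ≥0. *)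

(* Defs.v *)
(* MathComp-Analysis *)
From HB Require Import structures.
From mathcomp Require Import all_boot all_order all_algebra.
From mathcomp Require Import all_classical all_reals all_analysis measurable_realfun.

Set Implicit Arguments.
Unset Strict Implicit.
Unset Printing Implicit Defensive.

Import Order.TTheory GRing.Theory Num.Theory.
Import numFieldNormedType.Exports.

Local Open Scope classical_set_scope.
Local Open Scope ring_scope.

Section special_functions.
Context {R : realType}.
Implicit Types a b x z rho delta gam : R.

Definition Gamma x : R :=
  \int[lebesgue_measure]_(s in `]0, +oo[) (s `^ (x - 1) * expR (- s)).

(* a is the shape and b the rate *)
Definition gamma_pdf a b x : R :=
  if 0 < x then b `^ a / Gamma a * x `^ (a - 1) * expR (- b * x) else 0.

Definition mittag_leffler rho delta z : R :=
  limn (series (fun j : nat => z ^+ j / Gamma (rho * j%:R + delta))).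

Definition mittag_leffler3 gam rho delta z : R :=
  limn (series (fun j : nat =>
    Gamma (gam + j%:R) / Gamma gam
      * (z ^+ j / (j`!%:R * Gamma (rho * j%:R + delta))))).

End special_functions.

Section independence.
Context {d : measure_display} {T : measurableType d} {R : realType}.
Variable P : probability T R.

Definition mutually_independent {I : choiceType} {d' : measure_display}
    {U : measurableType d'} (X : I -> T -> U) : Prop :=
  forall (J : seq I) (B : I -> set U), uniq J ->
    (forall i, measurable (B i)) ->
    (P (\bigcap_(i in [set` J]) X i @^-1` B i) =
     \prod_(i <- J) P (X i @^-1` B i))%E.

Definition sigma_of {I : Type} {d' : measure_display}
    {U : measurableType d'} (D : set I) (X : I -> T -> U) : set_system T :=
  <<s \bigcup_(i in D) preimage_set_system setT (X i) measurable >>.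

Definition independent_systems (F1 F2 : set_system T) : Prop :=
  forall A B, F1 A -> F2 B -> (P (A `&` B) = P A * P B)%E.

End independence.

Section processes.
Context {d : measure_display} {T : measurableType d} {R : realType}.
Variable P : probability T R.

(* Processes are indexed by R, but only their values at times in
   nonneg_times are ever constrained or used. *)
Definition nonneg_times : set R := [set s | 0 <= s].

(* Path properties hold surely.  Left limits exist automatically, and since
   the paths are nondecreasing the truncated subtraction of nat gives the
   true increments. *)
Record poisson_process (rate : R) (N : R -> {RV P >-> nat}) : Prop := {
  poisson_process0 : forall w, N 0 w = 0%N ;
  poisson_process_nondecreasing :
    forall w s t, 0 <= s -> s <= t -> (N s w <= N t w)%N ;
  poisson_process_right_continuous :
    forall w t, 0 <= t -> \forall s \near t^'+, N s w = N t w ;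
  poisson_process_independent_increments :
    forall tau : nat -> R, 0 <= tau 0%N ->
      {homo tau : i j / (i <= j)%N >-> i <= j} ->
      mutually_independent P
        (fun (i : nat) w => (N (tau i.+1) w - N (tau i) w)%N) ;
  poisson_process_increment_law :
    forall s t k, 0 <= s -> s < t ->
      P [set w | (N t w - N s w)%N = k] =
      (poisson_pmf (rate * (t - s)) k)%:E
}.

Definition gamma_distributed (a b : R) (X : {RV P >-> R}) : Prop :=
  forall A : set R, measurable A ->
    distribution P X A = (\int[lebesgue_measure]_(x in A) (gamma_pdf a b x)%:E)%E.

(* The jumps are numbered from 0. *)
Definition compound_sum (N : R -> T -> nat) (G : nat -> T -> R)
    (u : R) (w : T) : R :=
  \sum_(j < N u w) G j w.

(* N and G are the counting process and the jumps of a compound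
   Poisson-Erlang process with parameters rate, n, beta. *)
Record compound_poisson_erlang (rate : R) (n : nat) (beta : R)
    (N : R -> {RV P >-> nat}) (G : nat -> {RV P >-> R}) : Prop := {
  cpe_poisson : poisson_process rate N ;
  cpe_jumps_independent : mutually_independent P (fun j => G j : T -> R) ;
  cpe_jumps_law : forall j, gamma_distributed n%:R beta (G j) ;
  cpe_independent :
    independent_systems P (sigma_of nonneg_times (fun s => N s : T -> nat))
      (sigma_of setT (fun j => G j : T -> R))
}.

(* Equal to +oo where X never exceeds t. *)
Definition inverse_process (X : R -> T -> R) (t : R) (w : T) : \bar R :=
  ereal_inf [set u%:E | u in [set u : R | 0 <= u /\ t < X u w]].

(* Where Y t = +oo (a null event for the inverse of a compound Poisson-Erlang
   process), fine evaluates the process at time 0. *)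
Definition time_changed (N : R -> T -> nat) (Y : R -> T -> \bar R)
    (t : R) (w : T) : nat :=
  N (fine (Y t w)) w.

End processes.

Arguments poisson_process {d T R} P rate N.
Arguments compound_poisson_erlang {d T R} P rate n beta N G.

(* Main.v *)
(* Write S_j for the sum of the first j jumps and b_j = P(S_j > t).  Almost
   surely the jumps are positive, so Y(t) <= u holds exactly when S_{N(u)} > t,
   whence P(Y(t) <= u) = sum_j P(N(u) = j) b_j.  Since S_j has the gamma law of
   integer shape n j, b_j is the probability that a Poisson variable of mean
   beta t is less than n j.

   Conditioning on Y(t) and integrating by parts, P(Z(t) <= k) is the integral
   of lambda1 e^{-lambda1 u} (lambda1 u)^k / k! against P(Y(t) <= u) du, that is
   sum_j b_j C(j+k,k) q^{k+1} p^j, where p = lambda / (lambda1 + lambda) and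
   q = 1 - p.  Taking differences in k and summing by parts in j turns b_j into
   b_{j+1} - b_j, the sum of the n Poisson weights of mean beta t at
   n j, ..., n j + n - 1; this is the Mittag-Leffler series of the mass function.
   The Laplace transform then follows from the negative binomial series. *)
Require Import Defs.
From HB Require Import structures.
From mathcomp Require Import all_boot all_order all_algebra.
From mathcomp Require Import all_classical all_reals all_analysis measurable_realfun.
From mathcomp Require Import ring lra.

Import Order.TTheory GRing.Theory Num.Theory.
Import numFieldNormedType.Exports.

Local Open Scope classical_set_scope.
Local Open Scope ring_scope.

Set Implicit Arguments.
Unset Strict Implicit.
Unset Printing Implicit Defensive.

(** * Poisson weights and their integrals *)

(** Conditioning on Y(t) is the delicate step. Independence is available only for counts at fixed
    times, and [N1] is not assumed jointly measurable in time and outcome, so evaluation at a random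
    time is reached by rounding that time to a grid and letting the mesh tend to 0. This is why
    cumulative probabilities are computed before point masses: nondecreasing paths make the event
    N1(u) <= k decreasing in u, so it can be squeezed between the endpoints of a grid cell, which
    fails for N1(u) = k. The integration by parts is an instance of Tonelli and needs no density for
    Y(t). Exchanges of sums and integrals take place among nonnegative extended reals; real limits
    return only at the end. Two null events must be discarded: some jump is not positive, and Y(t)
    is infinite. *)

Section poisson_weight.
Context {R : realType}.
Implicit Types (r s x t : R) (k n : nat).

(* Unlike [poisson_pmf], which is the junk value 1 at rates [<= 0], this is
   still the Poisson weight at rate 0. *)
Definition pois r k : R := r ^+ k / k`!%:R * expR (- r).

(* The inequality is strict: [P(X < k)] for [X] of Poisson law of mean [r]. *)
Definition poiscdf k r : R := \sum_(i < k) pois r i.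

Lemma poisson_pmfE r k : 0 < r -> poisson_pmf r k = pois r k.
Proof. by rewrite /poisson_pmf /pois => ->. Qed.

Lemma pois_ge0 r k : 0 <= r -> 0 <= pois r k.
Proof. by move=> r0; rewrite mulr_ge0 ?expR_ge0// divr_ge0// exprn_ge0. Qed.

Lemma pois0 k : pois 0 k = (k == 0%N)%:R.
Proof.
rewrite /pois oppr0 expR0 mulr1 expr0n; case: k => [|k] /=.
  by rewrite fact0 divr1.
by rewrite mul0r.
Qed.

Lemma poiscdf0 k : poiscdf k.+1 0 = 1.
Proof.
rewrite /poiscdf big_ord_recl pois0/= big1 ?addr0// => i _.
by rewrite pois0.
Qed.

Lemma poiscdf_ge0 r k : 0 <= r -> 0 <= poiscdf k r.
Proof. by move=> r0; apply: sumr_ge0 => i _; exact: pois_ge0. Qed.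

Lemma poiscdfE r k : poiscdf k r = expR (- r) * series (exp_coeff r) k.
Proof.
rewrite /poiscdf /series/= mulr_sumr big_mkord; apply: eq_bigr => i _.
by rewrite /pois mulrC.
Qed.

Lemma cvg_poiscdf r : poiscdf k r @[k --> \oo] --> (1 : R).
Proof.
rewrite (_ : (fun k => poiscdf k r) =
  (fun k => expR (- r) * series (exp_coeff r) k)); last first.
  by apply/funext => k; rewrite poiscdfE.
rewrite -[X in _ --> X](@mulVf _ (expR r)) ?expR_eq0// -expRN.
by apply: cvgMr; exact: is_cvg_series_exp_coeff.
Qed.

Lemma nondecreasing_poiscdf r : 0 <= r -> nondecreasing_seq (fun k => poiscdf k r).
Proof.
move=> r0; apply/nondecreasing_seqP => k.
by rewrite /poiscdf big_ord_recr/= lerDl pois_ge0.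
Qed.

Lemma poiscdf_le1 r k : 0 <= r -> poiscdf k r <= 1.
Proof.
move=> r0; have cv := cvg_poiscdf r.
have := nondecreasing_cvgn_le (nondecreasing_poiscdf r0) _ k.
by rewrite (cvg_lim _ cv)//; apply.
Qed.

Lemma is_derive_pois r k :
  is_derive r 1 (pois ^~ k) ((if k is k'.+1 then pois r k' else 0) - pois r k).
Proof.
rewrite (_ : pois ^~ k = (k`!%:R^-1 \*: (id ^+ k)) * (expR \o -%R)); last first.
  apply/funext => x; rewrite /pois !fctE/=. by rewrite [_ / _]mulrC.
have dX : is_derive r 1 (@id R ^+ k) (k%:R * r ^+ k.-1).
  by apply: is_derive_eq; rewrite /GRing.scale/= mulr1.
have dE : is_derive r 1 (expR \o -%R) (- expR (- r)).
  by apply: is_derive_eq; rewrite mulrN1.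
apply: is_derive_eq; rewrite /pois exprfctE !/GRing.scale /= /GRing.scale /=.
case: k dX => [|k] _.
  by rewrite /= fact0 expr0; field.
rewrite factS natrM exprS.
by field; rewrite nat1r !pnatr_eq0 -lt0n fact_gt0.
Qed.

(** The derivatives of consecutive weights telescope, so only the last weight survives. Hence
    Poisson tails are distribution functions of gamma laws with integer shape. *)
Lemma is_derive_poiscdf r k : is_derive r 1 (poiscdf k.+1) (- pois r k).
Proof.
rewrite (_ : poiscdf k.+1 = \sum_(i < k.+1) (pois ^~ i)); last first.
  by apply/funext => x; rewrite /poiscdf fct_sumE.
have := @is_derive_sum _ _ _ k.+1 (fun i => pois ^~ i) r 1 _
  (fun i => is_derive_pois r i).
move=> /is_derive_eq; apply; elim: k => [|k IH].
  by rewrite big_ord_recl big_ord0/= addr0 add0r.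
by rewrite big_ord_recr/= IH addrA addNr add0r.
Qed.

Lemma is_derive_continuous (f : R -> R) x (df : R) :
  is_derive x 1 f df -> {for x, continuous f}.
Proof. by case=> d _; exact/differentiable_continuous/derivable1_diffP. Qed.

Lemma continuous_pois k : continuous (fun r : R => pois r k).
Proof. by move=> r; apply: is_derive_continuous; exact: is_derive_pois. Qed.

Lemma continuous_poiscdf k : continuous (poiscdf k : R -> R).
Proof.
move=> r; rewrite (_ : poiscdf k = \sum_(i < k) (pois ^~ i)); last first.
  by apply/funext => x; rewrite /poiscdf fct_sumE.
elim: k => [|k IH]; first by rewrite big_ord0; exact: cvg_cst.
by rewrite big_ord_recr/=; apply: continuousD IH _; exact: continuous_pois.
Qed.

Lemma pois_cvg0 k : pois r k @[r --> +oo] --> (0 : R).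
Proof.
apply: (@squeeze_cvgr _ _ _ _ (cst 0) (fun r => k.+1%:R * r^-1)).
- near=> r; have r0 : 0 < r by near: r; exact: nbhs_pinfty_gt.
  rewrite (pois_ge0 _ (ltW r0))/=.
  (* The exponential dominates its Taylor term of degree [k.+1]; being one degree above the weight,
     this term leaves a factor [r^-1]. *)
  have : r ^+ k.+1 / k.+1`!%:R <= expR r.
    by apply: le_trans (expR_ge1Dxn k (ltW r0)); rewrite lerDr.
  rewrite -(ler_pM2r (expR_gt0 (- r))) -expRD subrr expR0 => h.
  rewrite (_ : pois r k = k.+1%:R * r^-1 *
      (r ^+ k.+1 / k.+1`!%:R * expR (- r))); last first.
    rewrite /pois factS natrM exprS; field.
    by rewrite nat1r !pnatr_eq0 -!lt0n fact_gt0 gt_eqF.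
  by apply: ler_piMr => //; rewrite divr_ge0// ltW.
- exact: cvg_cst.
- rewrite -[X in _ --> X](mulr0 k.+1%:R); apply: cvgMr.
  by apply/gtr0_cvgV0; [exact: nbhs_pinfty_gt|exact: cvg_id].
Unshelve. all: by end_near. Qed.

Lemma poiscdf_cvg0 k : poiscdf k r @[r --> +oo] --> (0 : R).
Proof.
elim: k => [|k IH].
  rewrite (_ : poiscdf 0 = cst 0); first exact: cvg_cst.
  by apply/funext => x; rewrite /poiscdf big_ord0.
rewrite (_ : poiscdf k.+1 = poiscdf k + pois ^~ k); last first.
  by apply/funext => x; rewrite /poiscdf big_ord_recr.
by rewrite -[X in _ --> X](addr0 0); apply: cvgD => //; exact: pois_cvg0.
Qed.

(** * Integrals of Poisson weights *)

Lemma FTC2_is_derive (f F : R -> R) (a b : R) : a <= b -> continuous f ->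
  (forall x, is_derive x 1 F (f x)) ->
  (\int[lebesgue_measure]_(x in `[a, b]) (f x)%:E = (F b - F a)%:E)%E.
Proof.
move=> + cf dF; rewrite le_eqVlt => /predU1P[<-|ab].
  by rewrite set_itv1 integral_set1 subrr.
have cF (x : R) : {for x, continuous F} by apply: is_derive_continuous.
rewrite EFinB (@continuous_FTC2 _ f F)//.
- exact: continuous_subspaceT.
- split; first by move=> x _; have [] := dF x.
    exact: cvg_at_right_filter (cF a).
  exact: cvg_at_left_filter (cF b).
- by move=> x _; rewrite derive1E; have [] := dF x.
Qed.

Lemma FTC2y_is_derive (f F : R -> R) (a l : R) : (forall x, a <= x -> 0 <= f x) ->
  continuous f -> F x @[x --> +oo] --> l ->
  (forall x, is_derive x 1 F (f x)) ->
  (\int[lebesgue_measure]_(x in `[a, +oo[) (f x)%:E = (l - F a)%:E)%E.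
Proof.
move=> f0 cf Fl dF.
have cF (x : R) : {for x, continuous F} by apply: is_derive_continuous.
rewrite EFinB (@ge0_continuous_FTC2y _ f F a l)//.
- exact: continuous_subspaceT.
- exact: cvg_at_right_filter (cF a).
- by move=> x _; rewrite derive1E; have [] := dF x.
Qed.

Lemma is_derive_scaled (f : R -> R) (c x df : R) :
  is_derive (c * x) 1 f df -> is_derive x 1 (fun x => f (c * x)) (c * df).
Proof.
move=> fdf; have dc : is_derive x 1 (fun x => c * x) c.
  have := is_deriveZ c (is_derive_id x 1).
  by move=> /is_derive_eq; apply; rewrite /GRing.scale/= mulr1.
by have := @is_derive1_comp _ f (fun x => c * x) x _ _ fdf dc; rewrite mulrC.
Qed.

Lemma is_derive_reflected (f : R -> R) (c t x df : R) :
  is_derive (c * (t - x)) 1 f df ->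
  is_derive x 1 (fun x => f (c * (t - x))) (- (c * df)).
Proof.
move=> fdf; have dc : is_derive x 1 (fun x => c * (t - x)) (- c).
  have := is_deriveZ c (is_deriveB (is_derive_cst t x 1) (is_derive_id x 1)).
  by move=> /is_derive_eq; apply; rewrite /GRing.scale/= sub0r mulrN1.
by have := @is_derive1_comp _ f (fun x => c * (t - x)) x _ _ fdf dc; rewrite mulrN mulrC.
Qed.

Lemma integral_pois_tail (c a : R) k : 0 < c -> 0 <= a ->
  (\int[lebesgue_measure]_(x in `[a, +oo[) (c * pois (c * x) k)%:E =
   (poiscdf k.+1 (c * a))%:E)%E.
Proof.
move=> c0 a0.
rewrite -[poiscdf _ _]opprK -[- - _]add0r.
apply: (@FTC2y_is_derive _ (fun x => - poiscdf k.+1 (c * x)) _ 0).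
- move=> x ax; rewrite mulr_ge0 ?(ltW c0)// pois_ge0//.
  by rewrite mulr_ge0 ?(ltW c0)// (le_trans a0).
- move=> x; apply: cvgMr; apply: (@continuous_comp _ _ _ ( *%R c) (pois^~ k)).
    exact: mulrl_continuous.
  exact: continuous_pois.
- rewrite -oppr0; apply: cvgN.
  apply: (@cvg_comp _ _ _ ( *%R c) (poiscdf k.+1) _ (pinfty_nbhs R)).
    exact: gt0_cvgMry.
  exact: poiscdf_cvg0.
- move=> x; rewrite -[X in is_derive _ _ _ X]opprK.
  by rewrite -mulrN; apply: is_deriveN; apply: is_derive_scaled; exact: is_derive_poiscdf.
Qed.

(* Repeated integration by parts of the product of two Poisson weights: the
   derivatives of successive terms telescope. *)
Definition pois_conv_prim (c t x : R) a b : R :=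
  \sum_(l < b.+1) pois (c * x) (a + l).+1 * pois (c * (t - x)) (b - l).

Lemma is_derive_pois_mul c t x a b :
  is_derive x 1 (fun x => pois (c * x) a.+1 * pois (c * (t - x)) b)
   (c * (pois (c * x) a * pois (c * (t - x)) b -
         (if b is b'.+1 then pois (c * x) a.+1 * pois (c * (t - x)) b' else 0))).
Proof.
have d1 := is_derive_scaled (is_derive_pois (c * x) a.+1).
have d2 := is_derive_reflected (is_derive_pois (c * (t - x)) b).
have := is_deriveM d1 d2; move=> /is_derive_eq; apply.
by rewrite /GRing.scale/=; case: b {d1 d2} => [|b]; ring.
Qed.

Lemma is_derive_pois_conv_prim c t x a b :
  is_derive x 1 (fun x => pois_conv_prim c t x a b)
    (c * pois (c * (t - x)) b * pois (c * x) a).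
Proof.
rewrite /pois_conv_prim; elim: b a => [|b IH] a.
  rewrite (_ : (fun x => _) = (fun x => pois (c * x) a.+1 * pois (c * (t - x)) 0)).
    by have := is_derive_pois_mul c t x a 0; move=> /is_derive_eq; apply; ring.
  by apply/funext => y; rewrite big_ord_recl big_ord0 addr0 addn0 subn0.
rewrite (_ : (fun x => _) = (fun x => pois (c * x) a.+1 * pois (c * (t - x)) b.+1) +
  (fun x => \sum_(l < b.+1) pois (c * x) (a.+1 + l).+1 * pois (c * (t - x)) (b - l))).
  have := is_deriveD (is_derive_pois_mul c t x a b.+1) (IH a.+1).
  by move=> /is_derive_eq; apply; ring.
apply/funext => y; rewrite fctE big_ord_recl addn0 subn0; congr (_ + _).
by apply: eq_bigr => i _; rewrite /= addnS addSn subSS.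
Qed.

(** This is the convolution of the gamma laws of shapes [n.+1] and [m]: [c * pois (c * x) n] is the
    density of the first, [1 - poiscdf m (c * u)] the distribution function of the second. For
    [m = 0] the latter is the point mass at 0. *)
Lemma integral_pois_conv c t n m : 0 < c -> 0 <= t ->
  (\int[lebesgue_measure]_(u in `[0%R, t])
     (c * pois (c * (t - u)) n * (1 - poiscdf m (c * u)))%:E =
   (1 - poiscdf (n.+1 + m) (c * t))%:E)%E.
Proof.
move=> c0 t0.
(* An antiderivative of the integrand. At [u = t] only the summand [l = n] of each [pois_conv_prim]
   survives, giving the weights of index [n.+1 + i]; at [u = 0] every summand vanishes. *)
pose F u := poiscdf n.+1 (c * (t - u)) -
  \sum_(i < m) pois_conv_prim c t u i n.
have -> : 1 - poiscdf (n.+1 + m) (c * t) = F t - F 0.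
  rewrite /F subrr subr0 mulr0 poiscdf0.
  rewrite [X in _ - (_ - X)]big1 ?subr0; last first.
    move=> i _; rewrite /pois_conv_prim big1// => l _.
    by rewrite mulr0 pois0 mul0r.
  rewrite -addrA -opprD; congr (1 - _).
  rewrite /poiscdf big_split_ord/= addrC; congr (_ + _).
  apply: eq_bigr => i _.
  rewrite /pois_conv_prim big_ord_recr/= subrr mulr0 subnn pois0 mulr1.
  rewrite big1 ?add0r; last first.
    by move=> l _; rewrite pois0 subn_eq0 leqNgt ltn_ord mulr0.
  by rewrite /= addSn addnC.
apply: FTC2_is_derive => //.
- move=> u; apply: cvgM.
    apply: cvgMr; apply: (@continuous_comp _ _ _ (fun u => c * (t - u)) (pois^~ n)).
      by apply: cvgMr; apply: cvgB; [exact: cvg_cst|exact: cvg_id].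
    exact: continuous_pois.
  apply: cvgB; first exact: cvg_cst.
  apply: (@continuous_comp _ _ _ ( *%R c) (poiscdf m)).
    exact: mulrl_continuous.
  exact: continuous_poiscdf.
- move=> u.
  have d1 := is_derive_reflected (is_derive_poiscdf (c * (t - u)) n).
  have d2 := @is_derive_sum _ _ _ m (fun i u => pois_conv_prim c t u i n) u 1 _
    (fun i => is_derive_pois_conv_prim c t u i n).
  have -> : F = (fun u => poiscdf n.+1 (c * (t - u))) -
      \sum_(i < m) (fun u => pois_conv_prim c t u i n).
    by apply/funext => y; rewrite /F !fctE fct_sumE.
  have := is_deriveB d1 d2; move=> /is_derive_eq; apply.
  rewrite -mulr_sumr /poiscdf; ring.
Qed.

(** The product of the two weights is a binomial factor times a weight of rate [s + l], whose gamma
    density integrates to 1. Probabilistically, this is the chance that, in two merged independent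
    Poisson streams, the [k.+1]-st point of rate [s] is preceded by exactly [j] points of rate
    [l]. *)
Lemma integral_pois_product (s l : R) k j : 0 < s -> 0 < l ->
  (\int[lebesgue_measure]_(u in `[0%R, +oo[)
     (s * pois (s * u) k * pois (l * u) j)%:E =
   ('C(j + k, k)%:R * (s / (s + l)) ^+ k.+1 * (l / (s + l)) ^+ j)%:E)%E.
Proof.
move=> s0 l0; have sl0 : 0 < s + l by rewrite addr_gt0.
have lhs u : s * pois (s * u) k * pois (l * u) j =
    ('C(j + k, k)%:R * (s / (s + l)) ^+ k.+1 * (l / (s + l)) ^+ j) *
    ((s + l) * pois ((s + l) * u) (j + k)).
  set p := s / (s + l); set q := l / (s + l); set w := (s + l) * u.
  have su : s * u = p * w by rewrite /p /w; field; rewrite gt_eqF.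
  have lu : l * u = q * w by rewrite /q /w; field; rewrite gt_eqF.
  have sp : s = p * (s + l) by rewrite /p; field; rewrite gt_eqF.
  have wE : expR (- w) = expR (- (p * w)) * expR (- (q * w)).
    by rewrite -su -lu -expRD -opprD -mulrDl.
  have binE : ((j + k)`!%:R : R) = 'C(j + k, k)%:R * k`!%:R * j`!%:R.
    by rewrite -!natrM -mulnA -[in X in (_ * (_ * X))%N](addnK k j) bin_fact ?leq_addl.
  have C0 : ('C(j + k, k)%:R : R) != 0 by rewrite pnatr_eq0 -lt0n bin_gt0 leq_addl.
  have k0 : (k`!%:R : R) != 0 by rewrite pnatr_eq0 -lt0n fact_gt0.
  have j0 : (j`!%:R : R) != 0 by rewrite pnatr_eq0 -lt0n fact_gt0.
  clearbody p q w.
  rewrite su lu [in LHS]sp /pois wE binE !exprMn exprD exprS.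
  by field; rewrite C0 k0 j0.
under eq_integral do rewrite lhs EFinM.
rewrite ge0_integralZl//.
- by rewrite integral_pois_tail// mulr0 poiscdf0 mule1.
- apply/measurable_EFinP/measurable_funTS.
  apply: continuous_measurable_fun => x; apply: cvgMr.
  apply: (@continuous_comp _ _ _ ( *%R (s + l)) (pois^~ (j + k)%N)).
    exact: mulrl_continuous.
  exact: continuous_pois.
- move=> x; rewrite /= in_itv/= andbT => x0.
  by rewrite lee_fin mulr_ge0 ?(ltW sl0)// pois_ge0// mulr_ge0 ?(ltW sl0).
- by rewrite lee_fin !mulr_ge0// exprn_ge0// divr_ge0// ltW.
Qed.

(** * Gamma function and gamma densities at integers *)

Lemma GammaS n : Gamma n.+1%:R = n`!%:R :> R.
Proof.
have mp : measurable_fun setT (fun x : R => pois x n).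
  by apply: continuous_measurable_fun => x; exact: continuous_pois.
rewrite /Gamma /Rintegral.
rewrite (_ : (\int[_]_(_ in _) _)%E = (n`!%:R)%:E)//.
transitivity (\int[lebesgue_measure]_(x in `]0%R, +oo[)
    ((n`!%:R : R)%:E * (pois x n)%:E))%E.
  apply: eq_integral => x; rewrite inE/= in_itv/= andbT => x0.
  rewrite -natr1 addrK powR_mulrn ?ltW// -EFinM; congr EFin.
  by rewrite /pois; field; rewrite pnatr_eq0 -lt0n fact_gt0.
have h x : `]0%R, +oo[%classic x -> (0%R <= (pois x n)%:E :> \bar R)%E.
  by rewrite /= in_itv/= andbT => x0; rewrite lee_fin pois_ge0// ltW.
rewrite ge0_integralZl//; last first.
  exact/measurable_EFinP/measurable_funTS.
rewrite integral_itv_obnd_cbnd; last exact/measurable_EFinP/measurable_funTS.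
have := @integral_pois_tail 1 0 n ltr01 (lexx _).
rewrite mulr0 poiscdf0; under eq_integral do rewrite !mul1r.
by move=> ->; rewrite mule1.
Qed.

Lemma gamma_pdf_pois c x n : 0 < c -> 0 < x ->
  gamma_pdf n.+1%:R c x = c * pois (c * x) n.
Proof.
move=> c0 x0; rewrite /gamma_pdf x0 GammaS.
have -> : n.+1%:R - 1 = n%:R :> R by rewrite -natr1 addrK.
rewrite !powR_mulrn ?ltW// /pois exprMn exprS mulNr.
by field; rewrite pnatr_eq0 -lt0n fact_gt0.
Qed.

Lemma pois_le1 r k : 0 <= r -> pois r k <= 1.
Proof.
move=> r0; rewrite (le_trans _ (poiscdf_le1 k.+1 r0))//.
by rewrite /poiscdf big_ord_recr/= lerDr; exact: poiscdf_ge0.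
Qed.

(** The derivative is the opposite of a Poisson weight, hence lies in [-1, 0]. This controls the
    rounding error of a random time. *)
Lemma poiscdf_lipschitz (x y : R) k : 0 <= x -> x <= y ->
  poiscdf k.+1 y <= poiscdf k.+1 x <= poiscdf k.+1 y + (y - x).
Proof.
move=> x0 xy.
have [|c] := @MVT_segment R (poiscdf k.+1) (fun r => - pois r k) _ _ xy
    (fun r _ => is_derive_poiscdf r k).
  exact/continuous_subspaceT/continuous_poiscdf.
rewrite in_itv/= => /andP[xc _] E.
have c0 : 0 <= c by rewrite (le_trans x0).
have := pois_ge0 k c0; have := pois_le1 k c0; set p := pois c k in E * => p1 p0.
apply/andP; split.
  by rewrite -subr_le0 E mulNr oppr_le0 mulr_ge0// subr_ge0.
rewrite -lerBlDl; have -> : poiscdf k.+1 x - poiscdf k.+1 y = p * (y - x).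
  by rewrite -[RHS]opprK -mulNr -E opprB.
by rewrite ler_piMl// subr_ge0.
Qed.

End poisson_weight.

(** * Negative binomial and Mittag-Leffler series *)

Section series.
Context {R : realType}.
Implicit Types (u : nat -> R) (x p q : R).

(** Bridge between extended sums, where exchanges are free for nonnegative terms, and the real
    limits that define the Mittag-Leffler functions. *)
Lemma nneseries_cvg u x : (forall j, 0 <= u j) ->
  (\sum_(j <oo) (u j)%:E = x%:E)%E <-> series u @ \oo --> x.
Proof.
move=> u0; split => [ux|ux].
  have cu : cvgn (series u).
    by apply: nnseries_is_cvg => //; rewrite ux ltry.
  have := EFin_lim cu.
  rewrite (_ : EFin \o series u = fun n => \sum_(0 <= j < n) (u j)%:E)%E; last first.
    by apply/funext => n /=; rewrite sumEFin.
  by rewrite ux => -[->].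
have cu : cvgn (series u) by apply/cvg_ex; exists x.
have := EFin_lim cu.
rewrite (cvg_lim _ ux)// => <-; apply/congr_lim/funext => n /=.
by rewrite sumEFin.
Qed.

Lemma binS_pascal j k : 'C(j + k.+1, k.+1) = ('C(j + k, k.+1) + 'C(j + k, k))%N.
Proof. by rewrite addnS binS. Qed.

(** Multiplying by [1 - x] takes differences of coefficients, which Pascal's rule lowers from [k.+1]
    to [k]; truncation at [J] leaves a boundary term. *)
Lemma negative_binomial_step x k J :
  (1 - x) * series (fun j => 'C(j + k.+1, k.+1)%:R * x ^+ j) J =
  series (fun j => 'C(j + k, k)%:R * x ^+ j) J - 'C(J + k, k.+1)%:R * x ^+ J.
Proof.
rewrite /series/=; elim: J => [|J IH].
  by rewrite !big_geq// bin_small// mul0r subr0 mulr0.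
rewrite !big_nat_recr//= mulrDr IH addSn -addnS binS_pascal natrD exprS; ring.
Qed.

Lemma negative_binomial_cvg x k : 0 <= x -> x < 1 ->
  series (fun j => 'C(j + k, k)%:R * x ^+ j) @ \oo --> (1 - x)^-1 ^+ k.+1.
Proof.
move=> x0 x1; have x10 : 0 < 1 - x by rewrite subr_gt0.
elim: k => [|k IH].
  rewrite expr1 (_ : (fun j => _) = geometric 1 x); last first.
    by apply/funext => j /=; rewrite bin0.
  have -> : (1 - x)^-1 = 1 * (1 - x)^-1 by rewrite mul1r.
  by apply: cvg_geometric_series; rewrite ger0_norm.
set s := series _.
have nds : nondecreasing_seq s.
  apply/nondecreasing_seqP => n.
  by rewrite /s /series/= big_nat_recr//= lerDl mulr_ge0// exprn_ge0.
have cs : cvgn s.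
  apply: nondecreasing_is_cvgn => //.
  exists ((1 - x)^-1 ^+ k.+1 / (1 - x)) => _ [J _ <-].
  rewrite ler_pdivlMr// mulrC negative_binomial_step.
  rewrite (@le_trans _ _ (series (fun j => 'C(j + k, k)%:R * x ^+ j) J))//.
    by rewrite lerBlDr lerDl mulr_ge0// exprn_ge0.
  rewrite -(cvg_lim _ IH)//; apply: nondecreasing_cvgn_le; last first.
    by apply/cvg_ex; eexists; exact: IH.
  apply/nondecreasing_seqP => n.
  by rewrite /series/= big_nat_recr//= lerDl mulr_ge0// exprn_ge0.
have t0 := cvg_series_cvg_0 cs.
(* The boundary term is at most the general term of [s]. Convergence of [s] was therefore
   established beforehand, by monotonicity and boundedness alone. *)
have t1 : 'C(J + k, k.+1)%:R * x ^+ J @[J --> \oo] --> (0 : R).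
  apply: (@squeeze_cvgr _ _ _ _ (cst 0) (fun J => 'C(J + k.+1, k.+1)%:R * x ^+ J)).
  - apply: nearW => J /=; rewrite mulr_ge0 ?exprn_ge0//= ler_wpM2r ?exprn_ge0//.
    by rewrite ler_nat binS_pascal leq_addr.
  - exact: cvg_cst.
  - exact: t0.
have -> : s = (fun J => (1 - x)^-1 * (series (fun j => 'C(j + k, k)%:R * x ^+ j) J -
    'C(J + k, k.+1)%:R * x ^+ J)).
  by apply/funext => J; rewrite -negative_binomial_step mulKf// gt_eqF.
rewrite exprS -[(1 - x)^-1 ^+ k.+1]subr0; apply: cvgMr.
exact: cvgB.
Qed.

Lemma abel_summation (b e : nat -> R) J : b 0%N = 0 ->
  \sum_(0 <= j < J) b j * (e j - e j.+1) =
  \sum_(0 <= j < J) (b j.+1 - b j) * e j.+1 - b J * e J.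
Proof.
move=> b0; elim: J => [|J IH]; first by rewrite !big_geq// b0 mul0r subr0.
by rewrite !big_nat_recr//= IH; ring.
Qed.

Lemma negative_binomial_difference p q (b A : nat -> R) k :
  0 <= p -> p < 1 -> q = 1 - p -> b 0%N = 0 ->
  (forall j, 0 <= b j <= 1) ->
  (forall k, series (fun j => b j * ('C(j + k, k)%:R * q ^+ k.+1 * p ^+ j)) @ \oo
    --> A k) ->
  series (fun j => (b j.+1 - b j) * ('C(j + k, k)%:R * q ^+ k * p ^+ j.+1)) @ \oo -->
    A k - (if k is k'.+1 then A k' else 0).
Proof.
move=> p0 p1 qE b0 b01 bA.
(* By Pascal's rule, the coefficient of [b j] in the [k]-th series minus that
   in the preceding one is [e j - e j.+1]. *)
pose e j : R := if j is j'.+1 then 'C(j' + k, k)%:R * q ^+ k * p ^+ j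
  else (k == 0%N)%:R.
have e_cvg0 : e J @[J --> \oo] --> (0 : R).
  have /cvgP/cvg_series_cvg_0 h := @negative_binomial_cvg p k p0 p1.
  have : q ^+ k * p * ('C(j + k, k)%:R * p ^+ j) @[j --> \oo] --> q ^+ k * p * 0.
    by apply: cvgMr.
  rewrite mulr0 -[in X in _ -> X]cvg_shiftS.
  rewrite (_ : (fun j => _) = fun j => e j.+1)//.
  by apply/funext => j; rewrite /e exprS; ring.
have be_cvg0 : b J * e J @[J --> \oo] --> (0 : R).
  apply: (@squeeze_cvgr _ _ _ _ (cst 0) e).
  - apply: nearW => J /=; have /andP[bJ0 bJ1] := b01 J.
    have e0 : 0 <= e J.
      rewrite /e; case: J {bJ0 bJ1} => // J.
      by rewrite !mulr_ge0// exprn_ge0// qE subr_ge0 ltW.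
    by rewrite mulr_ge0//= ler_piMl.
  - exact: cvg_cst.
  - exact: e_cvg0.
have -> : series (fun j => (b j.+1 - b j) * ('C(j + k, k)%:R * q ^+ k * p ^+ j.+1)) =
  (fun J => (series (fun j => b j * ('C(j + k, k)%:R * q ^+ k.+1 * p ^+ j)) J -
    (if k is k'.+1 then
      series (fun j => b j * ('C(j + k', k')%:R * q ^+ k'.+1 * p ^+ j)) J
     else 0)) +
     b J * e J).
  apply/funext => J; apply/eqP; rewrite -subr_eq /series/=.
  rewrite -(abel_summation e J b0); apply/eqP.
  case: k @e {e_cvg0 be_cvg0} => [|k] e.
    rewrite subr0; apply: eq_bigr => -[|j] _; first by rewrite b0 !mul0r.
    by rewrite /e !bin0 qE expr0 expr1 [p ^+ j.+2]exprS; ring.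
  rewrite -sumrB; apply: eq_bigr => -[|j] _; first by rewrite b0 !mul0r subrr.
  rewrite /e; have -> : ('C(j.+1 + k.+1, k.+1) = 'C(j + k.+1, k.+1) + 'C(j.+1 + k, k))%N.
    by rewrite addSn binS addSnnS.
  by rewrite qE !natrD ![_ ^+ _.+1]exprS; ring.
rewrite -[X in _ --> X]addr0; apply: cvgD be_cvg0.
apply: cvgB; first exact: bA.
by case: k {e e_cvg0} => [|k]; [exact: cvg_cst|exact: bA].
Qed.

End series.

Lemma bin_le_exp2n n m : ('C(n, m) <= 2 ^ n)%N.
Proof.
elim: n m => [|n IH] [|m]; rewrite ?bin0 ?expn_gt0//.
by rewrite binS expnS mul2n -addnn leq_add.
Qed.

Section mittag_leffler_series.
Context {R : realType}.
Implicit Types (z p B : R) (n m k j : nat).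

(** General term of the three-parameter function with upper index [k.+1] and second lower index
    [m.+1]: at integers the quotient of Gamma values and factorials is a binomial coefficient.
    [k = 0] gives the two-parameter function. *)
Definition ml_term k n m z j : R :=
  'C(j + k, k)%:R * z ^+ j / (n * j + m)`!%:R.

Lemma mittag_lefflerE n m z :
  mittag_leffler n%:R m.+1%:R z = limn (series (ml_term 0 n m z)).
Proof.
rewrite /mittag_leffler; congr (limn (series _)); apply/funext => j.
by rewrite -natrM -natrD addnS GammaS /ml_term bin0 mul1r.
Qed.

Lemma mittag_leffler3E k n m z :
  mittag_leffler3 k.+1%:R n%:R m.+1%:R z = limn (series (ml_term k n m z)).
Proof.
rewrite /mittag_leffler3; congr (limn (series _)); apply/funext => j.
rewrite -natrM -!natrD addnS addSn !GammaS /ml_term.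
have -> : ((k + j)`!%:R : R) = 'C(j + k, k)%:R * k`!%:R * j`!%:R.
  by rewrite -!natrM -mulnA -[in X in (_ * (_ * X))%N](addnK k j) bin_fact ?leq_addl// addnC.
by field; rewrite !pnatr_eq0 -!lt0n !fact_gt0.
Qed.

(** Comparison with an exponential series at [2 * z]: the binomial coefficient is at most
    [2 ^ (j + k)], and [(n * j + m)!] is at least [j!] because [n] is positive. *)
Lemma is_cvg_ml_term k n m z : (0 < n)%N -> 0 <= z ->
  cvgn (series (ml_term k n m z)).
Proof.
move=> n0 z0.
apply: (@series_le_cvg _ _ (fun j => 2 ^+ k * exp_coeff (2 * z) j)).
- by move=> j; rewrite !mulr_ge0// exprn_ge0.
- by move=> j; rewrite mulr_ge0 ?exprn_ge0// divr_ge0// exprn_ge0// mulr_ge0.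
- move=> j; rewrite /ml_term /exp_coeff/= exprMn !mulrA -exprD addnC.
  rewrite ler_pM ?invr_ge0//.
  + by rewrite mulr_ge0// exprn_ge0.
  + by rewrite ler_wpM2r ?exprn_ge0// -natrX ler_nat bin_le_exp2n.
  + rewrite lef_pV2 ?posrE ?ltr0n ?fact_gt0// ler_nat leq_fact//.
    by rewrite (@leq_trans (n * j))// ?leq_addr// leq_pmull.
- rewrite (_ : (fun j => _) = 2 ^+ k *: exp_coeff (2 * z))//.
  by apply: is_cvg_seriesZ; exact: is_cvg_series_exp_coeff.
Qed.

(** The weights are regrouped by the residue [i] of their index modulo [n]: [B ^+ (n * j)] merges
    with [p ^+ j] into a power of [p * B ^+ n], leaving [B ^+ i] and one factor [p] outside. *)
Lemma ml_sum_cvg k n p B : (0 < n)%N -> 0 <= p -> 0 <= B ->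
  series (fun j => (\sum_(i < n) pois B (n * j + i)) * ('C(j + k, k)%:R * p ^+ j.+1))
  @ \oo -->
  expR (- B) * p * \sum_(i < n) B ^+ i * limn (series (ml_term k n i (p * B ^+ n))).
Proof.
move=> n0 p0 B0.
rewrite (_ : series _ = fun J => expR (- B) * p *
    \sum_(i < n) B ^+ i * series (ml_term k n i (p * B ^+ n)) J).
  apply: cvgMr; apply: cvg_big => [|i _]; first exact: add_continuous.
  apply: cvgMr.
  by apply: is_cvg_ml_term => //; rewrite mulr_ge0// exprn_ge0.
apply/funext => J; rewrite /series/=.
under [in RHS]eq_bigr do rewrite mulr_sumr.
rewrite exchange_big/= mulr_sumr; apply: eq_bigr => j _.
rewrite mulr_suml mulr_sumr; apply: eq_bigr => i _.
rewrite /pois /ml_term exprMn exprS exprD -exprM.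
by field; rewrite pnatr_eq0 -lt0n fact_gt0.
Qed.

End mittag_leffler_series.

(** * Independence and sums of gamma variables *)

Section probability_tools.
Context {d : measure_display} {T : measurableType d} {R : realType}.
Variable P : probability T R.

Lemma measurable_le_set (V : T -> R) u : measurable_fun setT V ->
  measurable [set w | V w <= u].
Proof.
move=> mV; rewrite -[X in measurable X]setTI.
by apply: measurable_fun_le => //; exact: measurable_cst.
Qed.

Lemma measurable_lt_set (V : T -> R) u : measurable_fun setT V ->
  measurable [set w | u < V w].
Proof.
move=> mV; rewrite (_ : [set _ | _] = ~` [set w | V w <= u]).
  by apply: measurableC; exact: measurable_le_set.
by apply/seteqP; split => w /=; rewrite ltNge => /negP.
Qed.

(** Tonelli on the region V(w) <= u. It acts as an integration by parts against the law of [V], and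
    serves both the convolution of jump laws and the random time change. *)
Lemma layer_cake (V : T -> R) (h : R -> R) : measurable_fun setT V ->
  measurable_fun setT h -> (forall u, 0 <= h u) ->
  (\int[P]_w \int[lebesgue_measure]_(u in `[V w, +oo[) (h u)%:E =
   \int[lebesgue_measure]_u ((h u)%:E * P [set w | (V w <= u)%R]))%E.
Proof.
move=> mV mh h0.
pose GR := measurableTypeR R.
pose D := [set p : T * GR | V p.1 <= p.2].
have mD : measurable D.
  rewrite -[D]setTI; apply: measurable_fun_le => //.
  exact: measurableT_comp.
transitivity (\int[P]_w \int[lebesgue_measure]_u
    ((h u)%:E * (\1_D (w, u))%:E))%E.
  apply: eq_integral => w _; rewrite integral_mkcond; apply: eq_integral => u _.
  rewrite patchE indicE /D; case: ifPn => uV.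
    rewrite mem_set ?mule1//=; move: uV; rewrite inE/= in_itv/= andbT//.
  rewrite memNset ?mule0//= => Vu; move: uV; rewrite mem_set//=.
  by rewrite in_itv/= Vu.
rewrite (fubini_tonelli (m1 := P) (m2 := lebesgue_measure)
  (fun p : T * GR => (h p.2)%:E * (\1_D p)%:E)%E)//=; last 2 first.
- apply: emeasurable_funM; apply/measurable_EFinP.
    exact: measurableT_comp.
  exact: measurable_indic.
- by move=> p; rewrite mule_ge0// lee_fin.
apply: eq_integral => u _.
rewrite ge0_integralZl//=.
- congr (_ * _)%E.
  rewrite (_ : (fun w => _) = (fun w => (\1_[set w | V w <= u] w)%:E)); last first.
    by apply/funext => w; rewrite !indicE /D; congr (_%:R%:E); apply/idP/idP; rewrite !inE.
  by rewrite integral_indic ?setIT//; exact: measurable_le_set.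
- apply: (measurableT_comp (f := EFin)) => //.
  exact: (measurableT_comp (measurable_indic mD) (pair2_measurable u)).
- by rewrite lee_fin.
Qed.
(** Independence on rectangles identifies the joint law with the product measure, whose value on [C]
    is an integral of sections. *)
Lemma independent_pair_law d1 d2 (T1 : measurableType d1)
    (T2 : measurableType d2) (X : T -> T1) (Y : T -> T2) :
  measurable_fun setT X -> measurable_fun setT Y ->
  (forall A B, measurable A -> measurable B ->
    P (X @^-1` A `&` Y @^-1` B) = P (X @^-1` A) * P (Y @^-1` B))%E ->
  forall C : set (T1 * T2), measurable C ->
  (P [set w | C (X w, Y w)] = \int[P]_w P (Y @^-1` (xsection C (X w))))%E.
Proof.
move=> mX mY XY C mC.
pose X' : {mfun T >-> T1} := HB.pack X (isMeasurableFun.Build _ _ _ _ _ mX).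
pose Y' : {mfun T >-> T2} := HB.pack Y (isMeasurableFun.Build _ _ _ _ _ mY).
have mXY : measurable_fun setT (fun w => (X w, Y w)).
  exact: measurable_fun_pair.
pose XY' : {mfun T >-> (T1 * T2)%type} :=
  HB.pack (fun w => (X w, Y w)) (isMeasurableFun.Build _ _ _ _ _ mXY).
rewrite -[LHS]/(distribution P XY' C).
rewrite -(@product_measure_unique _ _ _ _ R (distribution P X') (distribution P Y')
  (distribution P XY'))//.
rewrite /product_measure1 /= ge0_integral_pushforward//.
exact: measurable_fun_xsection.
Qed.

End probability_tools.

(** Rectangles are stable under intersection and generate the product sigma-algebra. Neither measure
    has to be a product, which allows comparing two laws of the same dependent-looking pair. *)
Lemma finite_measure_prod_unique d1 d2 (T1 : measurableType d1)
    (T2 : measurableType d2) (R : realType)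
    (m1 m2 : {measure set (T1 * T2) -> \bar R}) :
  (m1 setT < +oo)%E ->
  (forall A B, measurable A -> measurable B -> m1 (A `*` B) = m2 (A `*` B)) ->
  forall C, measurable C -> m1 C = m2 C.
Proof.
move=> m1oo m12 C mC.
pose K : set (set (T1 * T2)) :=
  [set D | exists A, measurable A /\ exists B, measurable B /\ D = A `*` B].
apply: (measure_unique K (fun=> setT)) => //.
- rewrite measurable_prod_measurableType //; congr (<<s _ >>).
  rewrite predeqE; split => [[A mA [B mB <-]]|[A [mA [B [mB ->]]]]].
    by exists A; split => //; exists B.
  by exists A => //; exists B.
- move=> _ _ [X1 [mX1 [X2 [mX2 ->]]]] [Y1 [mY1 [Y2 [mY2 ->]]]].
  rewrite -setXI; exists (X1 `&` Y1); split; first exact: measurableI.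
  by exists (X2 `&` Y2); split => //; exact: measurableI.
- by move=> _; exists setT; split => //; exists setT; split => //; rewrite setXTT.
- by rewrite bigcup_const//; exists 0%N.
- by move=> _ [A [mA [B [mB ->]]]]; exact: m12.
Qed.

(** * Law of the sums of jumps *)

Section partial_sums.
Context {d : measure_display} {T : measurableType d} {R : realType}.
Variables (P : probability T R) (G : nat -> {RV P >-> R}).

Definition partial_sum (j : nat) (w : T) : R := \sum_(i < j) G i w.

Lemma measurable_partial_sum j : measurable_fun setT (partial_sum j).
Proof. exact: measurable_sum. Qed.

Lemma partial_sumS j w : partial_sum j.+1 w = partial_sum j w + G j w.
Proof. by rewrite /partial_sum big_ord_recr. Qed.

Hypothesis G_indep : mutually_independent P (fun j => G j : T -> R).

(* The later jumps indexed by [J] are carried along because the step from [j]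
   to [j.+1] needs the joint law of the [j]-th sum and the [j]-th jump. *)
Lemma partial_sum_independent j (J : seq nat) (A : set R) (B : nat -> set R) :
  uniq J -> (forall i, i \in J -> (j <= i)%N) -> measurable A ->
  (forall i, measurable (B i)) ->
  (P (partial_sum j @^-1` A `&` \bigcap_(i in [set` J]) G i @^-1` B i) =
   P (partial_sum j @^-1` A) * \prod_(i <- J) P (G i @^-1` B i))%E.
Proof.
elim: j J A B => [|j IH] J A B uJ Jj mA mB.
  rewrite -G_indep//.
  have -> : partial_sum 0 = cst 0.
    by apply/funext => w; rewrite /partial_sum big_ord0.
  rewrite preimage_cst; case: ifP => _; first by rewrite setTI probability_setT mul1e.
  by rewrite set0I measure0 mul0e.
set E := \bigcap_(i in [set` J]) _.
have mE : measurable E.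
  apply: bigcap_measurableType => i _.
  by rewrite -[X in measurable X]setTI; exact: measurable_funPT.
pose c := NngNum (fine_ge0 (measure_ge0 P E)).
have mSG : measurable_fun setT (fun w => (partial_sum j w, G j w)).
  by apply: measurable_fun_pair => //; exact: measurable_partial_sum.
pose SG : {mfun T >-> (R * R)%type} :=
  HB.pack (fun w => (partial_sum j w, G j w)) (isMeasurableFun.Build _ _ _ _ _ mSG).
have PE : (P E = (c%:num)%:E)%E by rewrite /= fineK// fin_num_measure.
(* [m1] is the law of the pair formed by the [j]-th sum and the [j]-th jump, restricted to [E]; [m2]
   is the full law of that pair weighted by [P E]. They agree on rectangles by the induction
   hypothesis with [j] adjoined to [J], hence on [C], the preimage of [A] under addition. *)
pose m1 : {measure set (R * R) -> \bar R} := pushforward (mrestr P mE) SG.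
pose m2 : {measure set (R * R) -> \bar R} := mscale c (distribution P SG).
have key : forall C, measurable C ->
    m1 mSG C = m2 C.
  apply: finite_measure_prod_unique.
    rewrite /= /pushforward/mrestr preimage_setT setTI.
    by rewrite ltey_eq fin_num_measure.
  move=> A1 B1 mA1 mB1.
  rewrite -[LHS]/(P (SG @^-1` (A1 `*` B1) `&` E)).
  rewrite -[RHS]/((fine (P E))%:E * P (SG @^-1` (A1 `*` B1)))%E.
  pose B' i := if i == j then B1 else B i.
  have mB' i : measurable (B' i) by rewrite /B'; case: ifP.
  have jJ : j \notin J by apply/negP => /Jj; rewrite ltnn.
  have BB' i : i \in J -> B' i = B i.
    by move=> iJ; rewrite /B'; case: eqP => // ij; rewrite -ij iJ in jJ.
  have -> : SG @^-1` (A1 `*` B1) = partial_sum j @^-1` A1 `&`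
      \bigcap_(i in [set` [:: j]]) G i @^-1` B' i.
    apply/seteqP; split => w /=.
      move=> [? ?]; split => // i /=; rewrite inE => /eqP ->.
      by rewrite /B' eqxx.
    by move=> [? /(_ j)]; rewrite /= inE eqxx /B' eqxx => h; split => //; exact: h.
  have -> : partial_sum j @^-1` A1 `&`
      \bigcap_(i in [set` [:: j]]) G i @^-1` B' i `&` E =
      partial_sum j @^-1` A1 `&` \bigcap_(i in [set` j :: J]) G i @^-1` B' i.
    rewrite -setIA; congr (_ `&` _); apply/seteqP; split => w /=.
      move=> [h1 h2] i /=; rewrite inE => /predU1P[->|iJ].
        by apply: h1; rewrite /= inE.
      by rewrite BB'//; exact: h2.
    move=> h; split => [i|i iJ] /=.
      by rewrite inE => /eqP ->; apply: h; rewrite /= inE eqxx.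
    by rewrite -BB'//; apply: h; rewrite /= inE iJ orbT.
  rewrite !IH//=.
  - rewrite big_cons big_seq1 -PE G_indep// muleA muleC.
    congr (_ * _)%E; apply: eq_big_seq => i iJ.
    by rewrite BB'.
  - by move=> i; rewrite inE => /eqP ->.
  - by rewrite jJ.
  - move=> i; rewrite inE => /predU1P[->//|/Jj]; exact: ltnW.
pose C := (fun p : R * R => p.1 + p.2) @^-1` A.
have mC : measurable C.
  rewrite -[X in measurable X]setTI; apply: measurable_funD => //.
have := key _ mC.
rewrite -[m1 _ _]/(P (SG @^-1` C `&` E)) -[m2 _]/((fine (P E))%:E * P (SG @^-1` C))%E.
rewrite -PE G_indep// muleC.
suff -> : SG @^-1` C =
    partial_sum j.+1 @^-1` A by [].
by apply/seteqP; split => w /=; rewrite partial_sumS.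
Qed.

Variables (n : nat) (beta : R).
Hypothesis beta0 : 0 < beta.
Hypothesis G_law : forall j, gamma_distributed n.+1%:R beta (G j).

Lemma gamma_cdf i t :
  P [set w | G i w <= t] =
  (if t < 0 then 0 else 1 - poiscdf n.+1 (beta * t))%:E.
Proof.
have := G_law i (measurable_itv `]-oo, t]).
rewrite /distribution /pushforward /=.
rewrite (_ : _ @^-1` _ = [set w | G i w <= t]); last first.
  by apply/seteqP; split => w /=; rewrite in_itv.
move=> ->.
have mp : measurable_fun setT (fun x => beta * pois (beta * x) n).
  apply: continuous_measurable_fun => x; apply: cvgMr.
  apply: (@continuous_comp _ _ _ ( *%R beta) (pois^~ n)).
    exact: mulrl_continuous.
  exact: continuous_pois.
transitivity (\int[lebesgue_measure]_(x in `]0%R, t]) (beta * pois (beta * x) n)%:E)%E.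
  rewrite integral_mkcond [RHS]integral_mkcond; apply: eq_integral => x _.
  rewrite !patchE !mem_setE !in_itv/=.
  case: (ltP 0 x) => x0 /=; first by rewrite gamma_pdf_pois.
  by rewrite /gamma_pdf ltNge x0/=; case: ifP.
case: ltP => t0.
  rewrite set_itv_ge ?integral_set0// bnd_simp -leNgt ltW//.
rewrite integral_itv_obnd_cbnd; last exact/measurable_EFinP/measurable_funTS.
have -> : 1 - poiscdf n.+1 (beta * t) =
    - poiscdf n.+1 (beta * t) - - poiscdf n.+1 (beta * 0).
  by rewrite mulr0 poiscdf0 opprK addrC.
apply: (@FTC2_is_derive _ _ (fun x => - poiscdf n.+1 (beta * x))) => //.
  move=> x; apply: cvgMr.
  apply: (@continuous_comp _ _ _ ( *%R beta) (pois^~ n)).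
    exact: mulrl_continuous.
  exact: continuous_pois.
move=> x; rewrite -[X in is_derive _ _ _ X]opprK -mulrN.
by apply: is_deriveN; apply: is_derive_scaled; exact: is_derive_poiscdf.
Qed.

Lemma gamma_sum_cdf j t :
  P [set w | partial_sum j w <= t] =
  (if t < 0 then 0 else 1 - poiscdf (n.+1 * j) (beta * t))%:E.
Proof.
elim: j t => [|j IH] t.
  have -> : partial_sum 0 = cst 0.
    by apply/funext => w; rewrite /partial_sum big_ord0.
  rewrite /= muln0 /poiscdf big_ord0 subr0; case: ltP => t0.
    rewrite (_ : [set _ | _] = set0) ?measure0//.
    by apply/seteqP; split => w //=; rewrite leNgt t0.
  rewrite (_ : [set _ | _] = setT) ?probability_setT//.
  by apply/seteqP; split => w.
(* The density of one jump at [t - u], cut off beyond [t]. Its integral from [s] to infinity is the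
   probability that a jump is at most [t - s], the form required by [layer_cake]. *)
pose h u := beta * pois (beta * (t - u)) n * \1_(`]-oo, t]) u.
have cp u : {for u, continuous (fun u => beta * pois (beta * (t - u)) n)}.
  apply: cvgMr; apply: (@continuous_comp _ _ _ (fun u => beta * (t - u)) (pois^~ n)).
    by apply: cvgMr; apply: cvgB; [exact: cvg_cst|exact: cvg_id].
  exact: continuous_pois.
have mh : measurable_fun setT h.
  apply: measurable_funM; first exact: continuous_measurable_fun.
  exact: measurable_indic.
have h0 u : 0 <= h u.
  rewrite /h indicE; case: (boolP (u \in _)) => [|_]; last by rewrite mulr0.
  rewrite inE/= in_itv/= => ut; rewrite mulr1.
  by rewrite mulr_ge0 ?(ltW beta0)// pois_ge0// mulr_ge0 ?(ltW beta0)// subr_ge0.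
have mC : measurable ([set p : R * R | p.1 + p.2 <= t]).
  rewrite -[X in measurable X]setTI.
  by apply: measurable_fun_le => //; exact: measurable_funD.
have indSG A B : measurable A -> measurable B ->
    (P (partial_sum j @^-1` A `&` G j @^-1` B) =
     P (partial_sum j @^-1` A) * P (G j @^-1` B))%E.
  move=> mA mB.
  have := @partial_sum_independent j [:: j] A (fun=> B).
  rewrite big_seq1 => <-//; last by move=> i; rewrite inE => /eqP ->.
  congr (P (_ `&` _)); apply/seteqP; split => w /=.
    by move=> h1 i /=; rewrite inE => /eqP ->.
  by apply; rewrite /= inE.
have := independent_pair_law (measurable_partial_sum j) (measurable_funPT (G j)) indSG mC.
rewrite (_ : [set w | _] = [set w | partial_sum j.+1 w <= t]); last first.
  by apply/seteqP; split => w /=; rewrite partial_sumS.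
move=> ->.
transitivity (\int[P]_w \int[lebesgue_measure]_(u in `[partial_sum j w, +oo[) (h u)%:E)%E.
  apply: eq_integral => w _.
  rewrite (_ : _ @^-1` _ = [set v | G j v <= t - partial_sum j w]); last first.
    by apply/seteqP; split => v /=; rewrite /xsection/= inE/= lerBrDl.
  rewrite gamma_cdf subr_lt0; set s := partial_sum j w.
  transitivity (\int[lebesgue_measure]_(u in `[s, t]) (beta * pois (beta * (t - u)) n)%:E)%E.
    case: ltP => ts.
      by rewrite set_itv_ge ?integral_set0// bnd_simp -ltNge.
    have -> : 1 - poiscdf n.+1 (beta * (t - s)) =
        poiscdf n.+1 (beta * (t - t)) - poiscdf n.+1 (beta * (t - s)).
      by rewrite subrr mulr0 poiscdf0.
    apply: esym.
    apply: (@FTC2_is_derive _ _ (fun x => poiscdf n.+1 (beta * (t - x)))) => // x.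
    rewrite -[X in is_derive _ _ _ X]opprK -mulrN; apply: is_derive_reflected.
    exact: is_derive_poiscdf.
  rewrite integral_mkcond [RHS]integral_mkcond; apply: eq_integral => u _.
  rewrite !patchE /h indicE !mem_setE !in_itv/= andbT.
  by case: (s <= u) => //=; case: (u <= t); rewrite ?mulr1// mulr0.
rewrite (layer_cake P (measurable_partial_sum j) mh h0).
transitivity (\int[lebesgue_measure]_(u in `[0%R, t])
     (beta * pois (beta * (t - u)) n * (1 - poiscdf (n.+1 * j) (beta * u)))%:E)%E.
  rewrite [RHS]integral_mkcond; apply: eq_integral => u _.
  rewrite IH -EFinM patchE /h indicE !mem_setE !in_itv/=.
  case: ltP => u0 /=; first by rewrite mulr0.
  by case: (u <= t); rewrite ?mulr1// mulr0 mul0r.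
case: ltP => t0; first by rewrite set_itv_ge ?integral_set0// bnd_simp -ltNge.
by rewrite integral_pois_conv// mulnS.
Qed.

End partial_sums.

(** * The inverse of the compound process *)

Section events.
Context {d : measure_display} {T : measurableType d} {R : realType}.
Variable P : probability T R.

Lemma eq_probability_mod0 (D A B : set T) : measurable D -> measurable A ->
  measurable B -> P (~` D) = 0%E -> A `&` D = B `&` D -> P A = P B.
Proof.
move=> mD mA mB D0 AB.
have h C : measurable C -> P C = P (C `&` D).
  move=> mC; rewrite (measureDI P mC mD) [X in (X + _)%E](_ : _ = 0%E) ?add0e//.
  apply/eqP; rewrite -measure_le0 -D0 le_measure ?inE//.
  - exact: measurableD.
  - exact: measurableC.
by rewrite (h A mA) AB -(h B mB).
Qed.

Lemma probability_partition (M : T -> nat) (A : set T) :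
  (forall k, measurable [set w | M w = k]) -> measurable A ->
  P A = (\sum_(k <oo) P (A `&` [set w | M w = k]))%E.
Proof.
move=> mM mA.
rewrite -measure_semi_bigcup.
- congr (P _); apply/seteqP; split=> [w Aw|w [k _ []]//].
  by exists (M w).
- by move=> k; exact: measurableI.
- by move=> i j _ _ [w [[_ /= <-] [_ /= <-]]].
- by apply: bigcup_measurable => k _; exact: measurableI.
Qed.

Lemma integral_partition (M : T -> nat) (f : T -> \bar R) :
  (forall k, measurable [set w | M w = k]) -> measurable_fun setT f ->
  (forall w, 0 <= f w)%E ->
  (\int[P]_w f w = \sum_(k <oo) \int[P]_(w in [set w | M w = k]) f w)%E.
Proof.
move=> mM mf f0.
have MT : \bigcup_k [set w | M w = k] = setT.
  by apply/seteqP; split => // w _; exists (M w).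
rewrite -[in LHS]MT ge0_integral_bigcup// ?MT//.
by move=> i j _ _ [w [/= <- <-]].
Qed.

Variables (rate : R) (N : R -> {RV P >-> nat}).
Hypothesis rate0 : 0 < rate.
Hypothesis N_poisson : poisson_process P rate N.

Lemma poisson_marginal u k : 0 <= u ->
  P [set w | N u w = k] = (pois (rate * u) k)%:E.
Proof.
rewrite le_eqVlt => /predU1P[<-|u0].
  rewrite mulr0 pois0; case: k => [|k] /=.
    rewrite (_ : [set _ | _] = setT) ?probability_setT//.
    by apply/seteqP; split => w //= _; rewrite (poisson_process0 N_poisson).
  rewrite (_ : [set _ | _] = set0) ?measure0//.
  by apply/seteqP; split => w //=; rewrite (poisson_process0 N_poisson).
rewrite -poisson_pmfE ?mulr_gt0// -[X in rate * X]subr0.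
rewrite -(poisson_process_increment_law N_poisson k (lexx 0) u0).
congr (P _); apply/seteqP; split => w /=;
  by rewrite (poisson_process0 N_poisson) subn0.
Qed.

Lemma measurable_poisson_event u (Q : nat -> Prop) :
  measurable [set w | Q (N u w)].
Proof.
rewrite -[X in measurable X]setTI.
by apply: (measurable_funPT (N u) measurableT [set k | Q k]).
Qed.

Lemma poisson_cdf u k : 0 <= u ->
  P [set w | (N u w <= k)%N] = (poiscdf k.+1 (rate * u))%:E.
Proof.
move=> u0; rewrite /poiscdf.
rewrite (_ : [set _ | _] = \bigcup_(i < k.+1) [set w | N u w = i]); last first.
  by apply/seteqP; split => w /= => [Nk|[i /= + ->]//]; exists (N u w).
rewrite bigcup_mkord measure_semi_additive_ord//=.
- by rewrite -sumEFin; apply: eq_bigr => i _; exact: poisson_marginal.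
- by move=> i; exact: (measurable_poisson_event u (fun k => k = i)).
- by move=> i j _ _ [w [/= Ni Nj]]; apply/val_inj; rewrite /= -Ni Nj.
- by apply: bigsetU_measurable => i _;
    exact: (measurable_poisson_event u (fun k => k = i)).
Qed.

(** A right-continuous path with integer values is constant just after [u], so its value is also
    taken at a nearby rational time. Events over a continuum of times thus become countable
    unions. *)
Lemma poisson_rational_right w u a : 0 <= u -> u < a ->
  exists q : rat, u < ratr q < a /\ N (ratr q) w = N u w.
Proof.
move=> u0 ua.
have [e /= e0 ue] := poisson_process_right_continuous N_poisson w u0.
have : u < Num.min a (u + e) by rewrite lt_min ua ltrDl.
move=> /rat_in_itvoo[q]; rewrite in_itv/= lt_min => /and3P[uq qa que].
exists q; split; first by rewrite uq.
apply: ue => //=; rewrite ltr_norml; apply/andP; split; lra.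
Qed.

End events.

Section inverse.
Context {d : measure_display} {T : measurableType d} {R : realType}.
Variable P : probability T R.
Variables (n : nat) (rate beta : R).
Hypotheses (rate0 : 0 < rate) (beta0 : 0 < beta).
Variables (N : R -> {RV P >-> nat}) (G : nat -> {RV P >-> R}).
Hypothesis NG : compound_poisson_erlang P rate n.+1 beta N G.

Let Np : poisson_process P rate N := cpe_poisson NG.
Let X := compound_sum N G.
Let Y := inverse_process X.

Lemma compound_sumE u w : X u w = partial_sum G (N u w) w.
Proof. by []. Qed.

Lemma measurable_partial_sum_event j t :
  measurable [set w | t < partial_sum G j w].
Proof. by apply: measurable_lt_set; exact: measurable_partial_sum. Qed.

Lemma measurable_compound_event u t : measurable [set w | t < X u w].
Proof.
rewrite (_ : [set _ | _] = \bigcup_k ([set w | N u w = k] `&`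
   [set w | t < partial_sum G k w])); last first.
  apply/seteqP; split => w /=.
    by rewrite compound_sumE => h; exists (N u w).
  by move=> [k _ [/= <-]].
apply: bigcup_measurable => k _; apply: measurableI.
  exact: (measurable_poisson_event N u (fun j => j = k)).
exact: measurable_partial_sum_event.
Qed.

(** Strictness leaves room to move to a rational time. The equivalence holds on every path, without
    positivity of the jumps, and yields measurability of [Y t]. *)
Lemma inverse_process_ltP t w (a : R) :
  (Y t w < a%:E)%E <->
  exists q : rat, [/\ 0 <= (ratr q : R), (ratr q : R) < a & t < X (ratr q) w].
Proof.
split.
  move=> /ereal_inf_lt[_ [u [u0 tu] <-]]; rewrite lte_fin => ua.
  have [q [/andP[uq qa] NqE]] := poisson_rational_right Np w u0 ua.
  exists q; split => //; first by rewrite (le_trans u0)// ltW.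
  by rewrite compound_sumE NqE.
move=> [q [q0 qa tq]]; apply: (@le_lt_trans _ _ (ratr q)%:E); last by rewrite lte_fin.
by apply: ereal_inf_lbound; exists (ratr q).
Qed.

Lemma inverse_process_ge0 t w : (0 <= Y t w)%E.
Proof.
by apply: le_ereal_inf_tmp => _ [u [u0 _] <-]; rewrite lee_fin.
Qed.

Lemma measurable_inverse_process t : measurable_fun setT (Y t).
Proof.
apply: (measurability _ (ErealGenInftyO.measurableE R)) => _ /= -[_ [r ->] <-].
rewrite setTI (_ : _ @^-1` _ = \bigcup_(q in
    [set q : rat | 0 <= (ratr q : R) /\ (ratr q : R) < r])
   [set w | t < X (ratr q) w]).
  rewrite bigcup_mkcond; apply: bigcupT_measurable_rat => q.
  case: ifP => _ //; exact: measurable_compound_event.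
apply/seteqP; split => w /=.
  by rewrite in_itv/= => /inverse_process_ltP[q [q0 qr tq]]; exists q.
by move=> [q [q0 qr] tq]; rewrite in_itv/=; apply/inverse_process_ltP; exists q.
Qed.

(* The jumps are positive only almost surely; on this event the compound
   process is nondecreasing. *)
Definition positive_jumps : set T := \bigcap_j [set w | 0 < G j w].

Lemma measurable_positive_jumps : measurable positive_jumps.
Proof. by apply: bigcapT_measurable => j; exact: measurable_lt_set. Qed.

Lemma positive_jumps_ae : P (~` positive_jumps) = 0%E.
Proof.
apply/eqP; rewrite -measure_le0 setC_bigcap.
have mj j : measurable (~` [set w | 0 < G j w]).
  by apply: measurableC; exact: measurable_lt_set.
apply: (le_trans (measure_sigma_subadditive _ mj _ (@subset_refl _ _))).
  by apply: bigcup_measurable.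
rewrite eseries0// => j _ _.
rewrite (_ : ~` _ = [set w | G j w <= 0]); last first.
  by apply/seteqP; split => w /=; rewrite leNgt => /negP.
have := gamma_cdf beta0 (cpe_jumps_law NG) j 0.
by rewrite ltxx mulr0 poiscdf0 subrr.
Qed.

Lemma partial_sum_le w i j : positive_jumps w -> (i <= j)%N ->
  partial_sum G i w <= partial_sum G j w.
Proof.
move=> pw; elim: j => [|j IH]; first by rewrite leqn0 => /eqP ->.
rewrite leq_eqVlt ltnS => /predU1P[->//|/IH ij].
by rewrite partial_sumS (le_trans ij)// lerDl ltW//; exact: pw.
Qed.

Lemma compound_sum_le w u v : positive_jumps w -> 0 <= u -> u <= v ->
  X u w <= X v w.
Proof.
move=> pw u0 uv; rewrite !compound_sumE; apply: partial_sum_le => //.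
exact: poisson_process_nondecreasing Np _ _ _ _ _.
Qed.

Lemma inverse_process_leP t w u : positive_jumps w -> 0 <= u ->
  (Y t w <= u%:E)%E <-> t < X u w.
Proof.
move=> pw u0; split => [|tu]; last by apply: ereal_inf_lbound; exists u.
move=> Yu.
have [e /= e0 ue] := poisson_process_right_continuous Np w u0.
have [|q [q0 qe tq]] := (inverse_process_ltP t w (u + e)).1.
  by rewrite (le_lt_trans Yu)// lte_fin ltrDl.
(* The midpoint of [m] and [u + e] lies after the crossing time [ratr q] and strictly inside the
   interval to the right of [u] on which the path is constant. *)
pose m := Num.max u (ratr q).
have me : m < u + e by rewrite gt_max ltrDl e0.
have um : u <= m by rewrite le_max lexx.
have qm : ratr q <= m by rewrite le_max lexx orbT.
have <- : X ((m + (u + e)) / 2) w = X u w.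
  rewrite !compound_sumE ue//=; last by lra.
  by rewrite ltr_norml; apply/andP; split; lra.
by apply: (lt_le_trans tq); apply: compound_sum_le => //; lra.
Qed.

Definition jump_tail t j : R := poiscdf (n.+1 * j) (beta * t).

(** Measurability of the sum is replayed over the sigma-algebra generated by the jumps, since
    independence from [N] is stated for that sigma-algebra. *)
Lemma sigma_of_partial_sum j t :
  sigma_of setT (fun j => G j : T -> R) [set w | t < partial_sum G j w].
Proof.
rewrite /sigma_of; set F := \bigcup_(i in _) _.
pose T' := g_sigma_algebraType F.
suff mS : measurable_fun setT (partial_sum G j : T' -> R).
  exact: (@measurable_lt_set _ T' R _ t mS).
apply: (@measurable_sum _ T' R setT _ _ (fun i : 'I_j => G i : T' -> R)) => i _ A mA.
rewrite setTI; apply: sub_sigma_algebra; exists i => //.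
by exists A => //; rewrite setTI.
Qed.

Lemma compound_tail t u : 0 <= t -> 0 <= u ->
  P [set w | t < X u w] =
  (\sum_(j <oo) (pois (rate * u) j * jump_tail t j)%:E)%E.
Proof.
move=> t0 u0.
rewrite (probability_partition P (fun k => measurable_poisson_event N u (fun j => j = k))
  (measurable_compound_event u t)).
apply: eq_eseriesr => j _.
transitivity (P ([set w | N u w = j] `&` [set w | t < partial_sum G j w])).
  congr (P _); apply/seteqP; split => w /=; rewrite compound_sumE.
    by move=> [+ E]; rewrite E.
  by move=> [E]; rewrite E.
rewrite (cpe_independent NG).
- rewrite (poisson_marginal rate0 Np)// [RHS]EFinM; congr (_ * _)%E.
  rewrite (_ : [set _ | _] = ~` [set w | partial_sum G j w <= t]); last first.
    by apply/seteqP; split => w /=; rewrite ltNge => /negP.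
  rewrite probability_setC; last by apply: measurable_le_set; exact: measurable_partial_sum.
  rewrite (gamma_sum_cdf (cpe_jumps_independent NG) beta0 (cpe_jumps_law NG)).
  by rewrite ltNge t0/= -EFinB subKr.
- by apply: sub_sigma_algebra; exists u => //; exists [set j] => //; rewrite setTI.
- exact: sigma_of_partial_sum.
Qed.

Lemma inverse_cdf t u : 0 <= t -> 0 <= u ->
  P [set w | (Y t w <= u%:E)%E] =
  (\sum_(j <oo) (pois (rate * u) j * jump_tail t j)%:E)%E.
Proof.
move=> t0 u0; rewrite -compound_tail//.
apply: (eq_probability_mod0 measurable_positive_jumps _ _ positive_jumps_ae).
- rewrite -[X in measurable X]setTI; apply: emeasurable_fun_infty_c => //.
  exact: measurable_inverse_process.
- exact: measurable_compound_event.
- apply/seteqP; split => w /= [h pw]; split => //.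
    exact/inverse_process_leP.
  exact/(inverse_process_leP t pw).
Qed.

(** If the level is never exceeded then, for all [J] and [u], at most [J] jumps occur by time [u] or
    the sum of the first [J] jumps stays at or below [t]. A large [J] makes the second event
    unlikely, and then a large [u] the first. *)
Lemma inverse_process_pinfty t : 0 <= t -> P [set w | Y t w = +oo%E] = 0%E.
Proof.
move=> t0; set E := [set w | _].
have mE : measurable E.
  rewrite -[X in measurable X]setTI.
  exact: (measurable_inverse_process t measurableT (emeasurable_set1 +oo%E)).
suff h e : 0 < e -> (P E <= e%:E)%E.
  apply/eqP; rewrite -measure_le0; apply/lee_addgt0Pr => e e0.
  by rewrite add0e h.
move=> e0.
have [J hJ] : exists J, 1 - poiscdf (n.+1 * J) (beta * t) <= e / 2.
  have /cvgrPdist_le/(_ (e / 2))[|J _ hJ] := cvg_poiscdf (beta * t).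
    by rewrite divr_gt0.
  exists J; rewrite (le_trans (ler_norm _))// hJ//= leq_pmull//.
have [u u0 hu] : exists2 u, 0 <= u & poiscdf J.+1 (rate * u) <= e / 2.
  have /cvgrPdist_le/(_ (e / 2))[|A [_ hA]] := @poiscdf_cvg0 R J.+1.
    by rewrite divr_gt0.
  pose v := Num.max 1 (A + 1).
  have v0 : 0 < v by rewrite lt_max ltr01.
  exists (v / rate); first by rewrite divr_ge0// ltW.
  rewrite mulrC divfK ?gt_eqF//.
  have /hA : A < v by rewrite lt_max ltrDl ltr01 orbT.
  rewrite sub0r normrN; exact: le_trans (ler_norm _).
pose A := [set w | (N u w <= J)%N]; pose B := [set w | partial_sum G J w <= t].
have mA : measurable A := measurable_poisson_event N u (fun k => (k <= J)%N).
have mB : measurable B by apply: measurable_le_set; exact: measurable_partial_sum.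
have EAB : E `&` positive_jumps `<=` A `|` B.
  move=> w [/= Yoo pw]; rewrite /A /B /=.
  case: (leqP (N u w) J) => NJ; [by left|right].
  rewrite leNgt; apply/negP => tJ.
  suff : (Y t w <= u%:E)%E by rewrite Yoo.
  apply/inverse_process_leP => //; rewrite compound_sumE (lt_le_trans tJ)//.
  by apply: partial_sum_le => //; exact: ltnW.
have -> : P E = P (E `&` positive_jumps).
  apply: (eq_probability_mod0 measurable_positive_jumps _ _ positive_jumps_ae) => //.
    by apply: measurableI => //; exact: measurable_positive_jumps.
  by rewrite -setIA setIid.
have PAB : (P (E `&` positive_jumps) <= P A + P B)%E.
  apply: (@le_trans _ _ (P (A `|` B))); last exact: measureU2.
  apply: le_measure; rewrite ?inE//; last exact: measurableU.
  by apply: measurableI => //; exact: measurable_positive_jumps.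
apply: (le_trans PAB).
have -> : P A = (poiscdf J.+1 (rate * u))%:E by exact: poisson_cdf.
have -> : P B = (1 - poiscdf (n.+1 * J) (beta * t))%:E.
  have := gamma_sum_cdf (cpe_jumps_independent NG) beta0 (cpe_jumps_law NG) J t.
  by rewrite ltNge t0.
rewrite -EFinD lee_fin; lra.
Qed.

End inverse.

(** * A Poisson process at an independent random time *)

Section random_time.
Context {d : measure_display} {T : measurableType d} {R : realType}.
Variable P : probability T R.
Variables (rate : R) (N : R -> {RV P >-> nat}) (V : T -> R).
Hypothesis rate0 : 0 < rate.
Hypothesis N_poisson : poisson_process P rate N.
Hypothesis mV : measurable_fun setT V.
Hypothesis V0 : forall w, 0 <= V w.
Hypothesis NV : forall u k A, 0 <= u -> measurable A ->
  (P ([set w | (N u w <= k)%N] `&` V @^-1` A) =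
   P [set w | (N u w <= k)%N] * P (V @^-1` A))%E.

(** Right-continuity supplies a rational time after [V w] with the same count; conversely monotone
    paths bound the count at [V w] by that at any later rational. *)
Lemma measurable_random_time_event k :
  measurable [set w | (N (V w) w <= k)%N].
Proof.
rewrite (_ : [set _ | _] = \bigcup_(q : rat) ([set w | V w < ratr q] `&`
    [set w | (N (ratr q) w <= k)%N])).
  apply: bigcupT_measurable_rat => q; apply: measurableI.
    rewrite (_ : [set _ | _] = ~` [set w | ratr q <= V w]).
      apply: measurableC; rewrite -[X in measurable X]setTI.
      by apply: measurable_fun_le => //; exact: measurable_cst.
    by apply/seteqP; split => w /=; rewrite ltNge => /negP.
  exact: (measurable_poisson_event N (ratr q) (fun j => (j <= k)%N)).
apply/seteqP; split => w /=.
  move=> Nk.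
  have V1 : V w < V w + 1 by rewrite ltrDl.
  have [q [/andP[Vq _] NqE]] := poisson_rational_right N_poisson w (V0 w) V1.
  by exists q => //; split => //=; rewrite NqE.
move=> [q _ [/= Vq Nq]]; apply: leq_trans Nq.
by apply: (poisson_process_nondecreasing N_poisson); rewrite ?V0// ltW.
Qed.

Let F k w := (poiscdf k.+1 (rate * V w))%:E.

Let mF k : measurable_fun setT (F k).
Proof.
apply/measurable_EFinP; apply: (@measurableT_comp _ _ _ _ _ _ (poiscdf k.+1)).
  exact: continuous_measurable_fun (@continuous_poiscdf _ _).
exact: measurable_funM.
Qed.

Let F0 k w : (0 <= F k w)%E.
Proof. by rewrite lee_fin poiscdf_ge0// mulr_ge0// ltW. Qed.

(* On the event [V w \in `[i * h, i.+1 * h[] the values of [N] at both endpoints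
   bound [N (V w) w] and are independent of [V]; the Lipschitz bound makes the
   resulting error at most [rate * h]. *)
Section grid.
Variables (h : R) (k : nat).
Hypothesis h0 : 0 < h.

Let M w := Num.truncn (V w / h).
Let I i := [set w | M w = i].
Let A := [set w | (N (V w) w <= k)%N].
Let r i : R := poiscdf k.+1 (rate * (i%:R * h)).

Let gridP i w : I i w <-> (i%:R * h <= V w < i.+1%:R * h).
Proof.
have V0h : 0 <= V w / h by rewrite divr_ge0// ltW.
rewrite /I/= /M; split => [/eqP|H].
  by rewrite truncn_eq// ler_pdivlMr// ltr_pdivrMr.
by apply/eqP; rewrite truncn_eq// ler_pdivlMr// ltr_pdivrMr.
Qed.

Let IE i : I i = V @^-1` `[i%:R * h, i.+1%:R * h[.
Proof. by apply/seteqP; split => w /=; rewrite in_itv/= => /gridP. Qed.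

Let mI i : measurable (I i).
Proof. by rewrite IE -[X in measurable X]setTI; exact: mV. Qed.

Let mA : measurable A.
Proof. exact: measurable_random_time_event. Qed.

Let ih0 i : 0 <= i%:R * h. Proof. by rewrite mulr_ge0// ltW. Qed.

Let lipF i w : I i w ->
  r i.+1 <= poiscdf k.+1 (rate * V w) <= r i /\ r i <= r i.+1 + rate * h.
Proof.
move=> /gridP/andP[iV Vi].
have le1 : rate * (i%:R * h) <= rate * V w by rewrite ler_pM2l.
have le2 : rate * V w <= rate * (i.+1%:R * h) by rewrite ler_pM2l// ltW.
have r1 : 0 <= rate * (i%:R * h) by rewrite mulr_ge0// ltW.
have r2 : 0 <= rate * V w by rewrite mulr_ge0// ltW.
have /andP[a1 _] := poiscdf_lipschitz k r1 le1.
have /andP[a2 _] := poiscdf_lipschitz k r2 le2.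
have /andP[_] := poiscdf_lipschitz k r1 (le_trans le1 le2).
rewrite (_ : rate * (i.+1%:R * h) - rate * (i%:R * h) = rate * h) => [a3|].
  by split; [rewrite a1 a2|].
by rewrite -natr1; ring.
Qed.

Let PNI i j : P ([set w | (N (j%:R * h) w <= k)%N] `&` I i) = ((r j)%:E * P (I i))%E.
Proof. by rewrite IE NV// (poisson_cdf rate0 N_poisson). Qed.

Let grid_upper : (P A <= \int[P]_w F k w + (rate * h)%:E)%E.
Proof.
rewrite (probability_partition P mI mA).
have -> : (\int[P]_w F k w + (rate * h)%:E = \int[P]_w (F k w + (rate * h)%:E))%E.
  rewrite ge0_integralD//.
  - rewrite integral_cst//; congr (_ + _)%E; rewrite -[LHS]mule1.
    by congr (_ * _)%E; exact/esym/(@probability_setT _ _ _ P).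
  - by move=> w _; rewrite lee_fin mulr_ge0// ltW.
rewrite (integral_partition P mI); last 2 first.
- by apply: emeasurable_funD => //; exact: measurable_cst.
- by move=> w; rewrite adde_ge0// lee_fin mulr_ge0// ltW.
apply: lee_nneseries => // i _.
apply: (@le_trans _ _ (P ([set w | (N (i%:R * h) w <= k)%N] `&` I i))).
  apply: le_measure; rewrite ?inE.
  - by apply: measurableI; [exact: mA|exact: mI].
  - apply: measurableI; last exact: mI.
    exact: (measurable_poisson_event N (i%:R * h) (fun j => (j <= k)%N)).
  - move=> w [/= NVk Ii]; split => //=; apply: leq_trans NVk.
    apply: (poisson_process_nondecreasing N_poisson) => //.
    by have /gridP/andP[] := Ii.
rewrite PNI -integral_cst//; apply: ge0_le_integral => //.
- move=> w _; rewrite lee_fin poiscdf_ge0// mulr_ge0// ltW//.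
- apply: measurable_funTS; apply: emeasurable_funD => //.
- move=> w Ii /=; have [/andP[a1 a2] a3] := lipF Ii.
  by rewrite /F -EFinD lee_fin (le_trans a3)// lerD2r.
Qed.

Let grid_lower : (\int[P]_w F k w <= P A + (rate * h)%:E)%E.
Proof.
rewrite (integral_partition P mI) //.
(* The error is shared among the cells in proportion to their probabilities, so infinitely many
   cells still cost only [rate * h] in total. *)
have -> : (P A + (rate * h)%:E =
    \sum_(i <oo) (P (A `&` I i) + (rate * h)%:E * P (I i)))%E.
  rewrite nneseriesD//; last first.
    by move=> i _ _; rewrite mule_ge0// lee_fin mulr_ge0// ltW.
  rewrite -(probability_partition P mI mA); congr (_ + _)%E.
  rewrite nneseriesZl//.
  have := probability_partition P mI measurableT.
  rewrite probability_setT; under eq_eseriesr do rewrite setTI.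
  by move=> <-; rewrite mule1.
apply: lee_nneseries => [i _ _|i _]; first exact: integral_ge0.
apply: (@le_trans _ _ ((r i.+1)%:E * P (I i) + (rate * h)%:E * P (I i))%E).
  rewrite -ge0_muleDl ?lee_fin; last 2 first.
  - by rewrite poiscdf_ge0// mulr_ge0// ltW.
  - by rewrite mulr_ge0// ltW.
  rewrite -EFinD -integral_cst//; apply: ge0_le_integral => //.
  - exact: mI.
  - apply: measurable_funTS; exact: mF.
  - move=> w Ii /=; have [/andP[a1 a2] a3] := lipF Ii.
    by rewrite /F lee_fin (le_trans a2).
rewrite leeD2r// -PNI; apply: le_measure; rewrite ?inE.
- apply: measurableI; last exact: mI.
  exact: (measurable_poisson_event N (i.+1%:R * h) (fun j => (j <= k)%N)).
- by apply: measurableI; [exact: mA|exact: mI].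
- move=> w [/= Nk Ii]; split => //=; apply: leq_trans Nk.
  apply: (poisson_process_nondecreasing N_poisson) => //.
  by have /gridP/andP[_ /ltW] := Ii.
Qed.

Lemma random_time_grid :
  (P [set w | (N (V w) w <= k)%N] <=
     \int[P]_w (poiscdf k.+1 (rate * V w))%:E + (rate * h)%:E /\
   \int[P]_w (poiscdf k.+1 (rate * V w))%:E <=
     P [set w | (N (V w) w <= k)%N] + (rate * h)%:E)%E.
Proof. by split; [exact: grid_upper|exact: grid_lower]. Qed.

End grid.

(** Mesh [e / rate] turns the grid error into an arbitrary positive [e], in both directions. *)
Lemma random_time_cdf k :
  (P [set w | (N (V w) w <= k)%N] = \int[P]_w (poiscdf k.+1 (rate * V w))%:E)%E.
Proof.
apply/eqP; rewrite eq_le; apply/andP; split; apply/lee_addgt0Pr => e e0;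
  have /(random_time_grid k) [] : 0 < e / rate by rewrite divr_gt0.
- by move=> + _; rewrite mulrC divfK// gt_eqF.
- by move=> _; rewrite mulrC divfK// gt_eqF.
Qed.

(** The integrand [poiscdf k.+1] is itself the tail integral of a gamma density, so [layer_cake]
    moves the integration onto the distribution function of [V]. *)
Lemma random_time_cdf_integral k :
  (P [set w | (N (V w) w <= k)%N] =
   \int[lebesgue_measure]_(u in `[0%R, +oo[)
     ((rate * pois (rate * u) k)%:E * P [set w | (V w <= u)%R]))%E.
Proof.
rewrite random_time_cdf.
pose h u := rate * pois (rate * u) k * \1_(`[0, +oo[) u.
have mh : measurable_fun setT h.
  apply: measurable_funM; last exact: measurable_indic.
  apply: continuous_measurable_fun => x; apply: cvgMr.
  apply: (@continuous_comp _ _ _ ( *%R rate) (pois^~ k)).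
    exact: mulrl_continuous.
  exact: continuous_pois.
have h0 u : 0 <= h u.
  rewrite /h indicE; case: (boolP (u \in _)) => [|_]; last by rewrite mulr0.
  rewrite inE/= in_itv/= andbT => u0; rewrite mulr1.
  by rewrite mulr_ge0 ?(ltW rate0)// pois_ge0// mulr_ge0 ?(ltW rate0).
have hE u : 0 <= u -> h u = rate * pois (rate * u) k.
  by move=> u0; rewrite /h indicE mem_set ?mulr1//= in_itv/= u0.
transitivity (\int[P]_w \int[lebesgue_measure]_(u in `[V w, +oo[) (h u)%:E)%E.
  apply: eq_integral => w _.
  rewrite -integral_pois_tail//; apply: eq_integral => u.
  by rewrite inE/= in_itv/= andbT => Vu; rewrite hE// (le_trans (V0 w)).
rewrite layer_cake// [RHS]integral_mkcond; apply: eq_integral => u _.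
rewrite patchE mem_setE in_itv/= andbT; case: ifP => u0; first by rewrite hE.
by rewrite /h indicE memNset ?mulr0 ?mul0e//= in_itv/= u0.
Qed.

End random_time.

(** * The time-changed process *)

Section time_changed_process.
Context {d : measure_display} {T : measurableType d} {R : realType}.
Variable P : probability T R.
Variables (n : nat) (lambda lambda1 beta : R).
Variables (N : R -> {RV P >-> nat}) (G : nat -> {RV P >-> R}).
Variable N1 : R -> {RV P >-> nat}.
Hypotheses (lambda0 : 0 < lambda) (lambda10 : 0 < lambda1) (beta0 : 0 < beta).
Hypothesis NG : compound_poisson_erlang P lambda n.+1 beta N G.
Hypothesis N1_poisson : poisson_process P lambda1 N1.

Let Y := inverse_process (compound_sum N G).
Let Z := time_changed N1 Y.

Hypothesis N1Y : independent_systems P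
  (sigma_of nonneg_times (fun s => N1 s : T -> nat))
  (sigma_of nonneg_times (fun s => Y s : T -> \bar R)).

Variable t : R.
Hypothesis t0 : 0 <= t.

Let V w := fine (Y t w).
Let p := lambda / (lambda1 + lambda).
Let q := lambda1 / (lambda1 + lambda).
Let b j := jump_tail n beta t j.

Let l0 : 0 < lambda1 + lambda. Proof. exact: addr_gt0. Qed.
Let p0 : 0 < p. Proof. exact: divr_gt0. Qed.
Let q0 : 0 < q. Proof. exact: divr_gt0. Qed.
Let qE : q = 1 - p.
Proof. by rewrite /q /p; field; rewrite gt_eqF. Qed.
Let p1 : p < 1. Proof. by rewrite -subr_gt0 -qE. Qed.
Let bt0 : 0 <= beta * t. Proof. by rewrite mulr_ge0// ltW. Qed.

Let mV : measurable_fun setT V.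
Proof.
apply: (@measurableT_comp _ _ _ _ _ _ (@fine R)); first exact: fine_measurable.
exact: (measurable_inverse_process NG t).
Qed.

Let V0 w : 0 <= V w.
Proof. by apply: fine_ge0; exact: inverse_process_ge0. Qed.

Let N1V u k A : 0 <= u -> measurable A ->
  (P ([set w | (N1 u w <= k)%N] `&` V @^-1` A) =
   P [set w | (N1 u w <= k)%N] * P (V @^-1` A))%E.
Proof.
move=> u0 mA; apply: N1Y; apply: sub_sigma_algebra.
  by exists u => //; exists [set j | (j <= k)%N] => //; rewrite setTI.
exists t => //; exists (fine @^-1` A); last by rewrite setTI.
by rewrite -[X in measurable X]setTI; exact: fine_measurable.
Qed.

(** Where [Y t] is infinite, [fine] returns 0 and the events for [V] and [Y] differ; that set is
    null. *)
Let V_cdf u : 0 <= u -> P [set w | V w <= u] =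
  (\sum_(j <oo) (pois (lambda * u) j * b j)%:E)%E.
Proof.
move=> u0.
transitivity (P [set w | (Y t w <= u%:E)%E]); last exact: (inverse_cdf lambda0 beta0 NG t0 u0).
have mY : measurable [set w | Y t w = +oo%E].
  rewrite -[X in measurable X]setTI.
  exact: (measurable_inverse_process NG t measurableT (emeasurable_set1 +oo%E)).
apply: (@eq_probability_mod0 _ _ _ P (~` [set w | Y t w = +oo%E])).
- exact: measurableC.
- exact: measurable_le_set.
- rewrite -[X in measurable X]setTI; apply: emeasurable_fun_infty_c => //.
  exact: (measurable_inverse_process NG t).
- by rewrite setCK; exact: (inverse_process_pinfty lambda0 beta0 NG t0).
- have YE w : Y t w <> +oo%E -> (V w)%:E = Y t w.
    by move=> Yoo; rewrite /V fineK// ge0_fin_numE ?inverse_process_ge0// ltey; apply/eqP.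
  apply/seteqP; split => w /= [h Yoo]; split => //.
    by rewrite -(YE w Yoo) lee_fin.
  by rewrite -lee_fin (YE w Yoo).
Qed.

Let c k j : R := 'C(j + k, k)%:R * q ^+ k.+1 * p ^+ j.

Let c_ge0 k j : 0 <= c k j.
Proof. by rewrite !mulr_ge0// exprn_ge0// ltW. Qed.

Let b_ge0 j : 0 <= b j. Proof. exact: poiscdf_ge0. Qed.

Let Z_cdf k : P [set w | (Z t w <= k)%N] = (\sum_(j <oo) (b j * c k j)%:E)%E.
Proof.
rewrite (random_time_cdf_integral lambda10 N1_poisson mV V0 N1V).
transitivity (\int[lebesgue_measure]_(u in `[0%R, +oo[)
  (\sum_(j <oo) (lambda1 * pois (lambda1 * u) k * pois (lambda * u) j * b j)%:E)%E)%E.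
  apply: eq_integral => u; rewrite inE/= in_itv/= andbT => u0.
  rewrite V_cdf// -nneseriesZl; last first.
    by move=> j _; rewrite lee_fin mulr_ge0// pois_ge0// mulr_ge0// ltW.
  by apply: eq_eseriesr => j _; rewrite -EFinM mulrA.
have cp (s : R) i : 0 < s -> continuous (fun u : R => pois (s * u) i).
  move=> s0 u; apply: (@continuous_comp _ _ _ ( *%R s) (pois^~ i)).
    exact: mulrl_continuous.
  exact: continuous_pois.
have pp (s : R) i (u : R) : 0 < s -> 0 <= u -> 0 <= pois (s * u) i :> R.
  by move=> s0 u0; rewrite pois_ge0// mulr_ge0// ltW.
have mprod j : measurable_fun setT
    (fun u : R => lambda1 * pois (lambda1 * u) k * pois (lambda * u) j).
  apply: measurable_funM; first apply: measurable_funM => //;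
    by apply: continuous_measurable_fun; exact: cp.
rewrite integral_nneseries//; last 2 first.
- move=> j; apply/measurable_funTS/measurable_EFinP.
  by apply: measurable_funM; [exact: mprod|exact: measurable_cst].
- move=> j u; rewrite /= in_itv/= andbT => u0.
  rewrite lee_fin; apply: mulr_ge0; last exact: b_ge0.
  by apply: mulr_ge0; [apply: mulr_ge0; [exact: ltW|exact: pp]|exact: pp].
apply: eq_eseriesr => j _.
under eq_integral do rewrite mulrC EFinM.
rewrite ge0_integralZl//; first last.
- by rewrite lee_fin.
- move=> u; rewrite /= in_itv/= andbT => u0.
  by rewrite lee_fin; apply: mulr_ge0; [apply: mulr_ge0; [exact: ltW|exact: pp]|exact: pp].
- apply/measurable_funTS/measurable_EFinP; exact: mprod.
- by rewrite integral_pois_product// -EFinM.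
Qed.

Let A k : R := fine (P [set w | (Z t w <= k)%N]).

Let mZle k : measurable [set w | (Z t w <= k)%N].
Proof. exact: (measurable_random_time_event N1_poisson mV V0 k). Qed.

Let AE k : P [set w | (Z t w <= k)%N] = (A k)%:E.
Proof. by rewrite /A fineK// fin_num_measure. Qed.

Let Zle_cvg k : series (fun j => b j * c k j) @ \oo --> A k.
Proof. by apply/nneseries_cvg; [move=> j; rewrite mulr_ge0|rewrite -AE Z_cdf]. Qed.

Let ZkE k : [set w | Z t w = k] = [set w | (Z t w <= k)%N] `\`
  (if k is k'.+1 then [set w | (Z t w <= k')%N] else set0).
Proof.
case: k => [|k].
  by rewrite setD0; apply/seteqP; split => w /=; rewrite leqn0 => /eqP.
apply/seteqP; split => w /=.
  by move=> ->; split => //; rewrite ltnn.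
by move=> [Zk /negP]; rewrite -ltnNge => kZ; apply/eqP; rewrite eqn_leq Zk.
Qed.

Lemma measurable_time_changed_event k : measurable [set w | Z t w = k].
Proof. by rewrite ZkE; apply: measurableD => //; case: k. Qed.

Let Z_pmfA k : P [set w | Z t w = k] =
  (A k - (if k is k'.+1 then A k' else 0))%:E.
Proof.
case: k => [|k].
  rewrite ZkE setD0 subr0; exact: AE.
transitivity (P [set w | (Z t w <= k.+1)%N] - P [set w | (Z t w <= k)%N])%E; last first.
  by rewrite !AE EFinB.
have -> : [set w | (Z t w <= k)%N] =
    [set w | (Z t w <= k.+1)%N] `&` [set w | (Z t w <= k)%N].
  by apply/seteqP; split => w //=; [move=> h; split => //; exact: leqW|case].
rewrite ZkE; apply: measureD => //.
by rewrite -ge0_fin_numE// fin_num_measure.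
Qed.

Let a j : R := \sum_(i < n.+1) pois (beta * t) (n.+1 * j + i).

Let aE j : b j.+1 - b j = a j.
Proof.
rewrite /b /jump_tail mulnS (addnC n.+1) /poiscdf big_split_ord/=.
by rewrite addrAC subrr add0r.
Qed.

Let b0 : b 0 = 0. Proof. by rewrite /b /jump_tail muln0 /poiscdf big_ord0. Qed.

Let a_ge0 j : 0 <= a j. Proof. by apply: sumr_ge0 => i _; exact: pois_ge0. Qed.

Let Z_pmf_series k :
  (\sum_(j <oo) (a j * ('C(j + k, k)%:R * q ^+ k * p ^+ j.+1))%:E)%E =
  P [set w | Z t w = k].
Proof.
rewrite Z_pmfA; apply/nneseries_cvg.
  by move=> j; rewrite !mulr_ge0// exprn_ge0// ltW.
under eq_fun do rewrite -aE.
apply: (negative_binomial_difference (ltW p0) p1 qE b0) => [j|k'].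
  by rewrite b_ge0 poiscdf_le1.
exact: Zle_cvg.
Qed.

Lemma time_changed_pmf k : P [set w | Z t w = k] =
  (expR (- (beta * t)) * (p * q ^+ k) *
   \sum_(i < n.+1) (beta * t) ^+ i *
     limn (series (ml_term k n.+1 i (p * (beta * t) ^+ n.+1))))%:E.
Proof.
rewrite -Z_pmf_series; apply/nneseries_cvg.
  by move=> j; rewrite !mulr_ge0// exprn_ge0// ltW.
rewrite mulrA -[X in X * _]mulrC -mulrA.
rewrite (_ : series _ = fun J => q ^+ k *
    series (fun j => a j * ('C(j + k, k)%:R * p ^+ j.+1)) J).
  by apply: cvgMr; apply: ml_sum_cvg => //; exact: ltW.
apply/funext => J; rewrite /series/= mulr_sumr; apply: eq_bigr => j _; ring.
Qed.

(** With x = exp(-theta), summing over [k] first gives a negative binomial series in [q * x], equal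
    to [(1 - q * x)^-1 ^+ j.+1]. This replaces [p] by [p' = p / (1 - q * x)] and leaves the series
    of the mass function at [k = 0]. The bound [0 <= theta] gives [q * x < 1]. *)
Lemma time_changed_laplace theta : 0 <= theta ->
  let p' := lambda / (lambda + lambda1 * (1 - expR (- theta))) in
  (\int[P]_w (expR (- theta * (Z t w)%:R))%:E =
  (expR (- (beta * t)) * p' *
   \sum_(i < n.+1) (beta * t) ^+ i *
     limn (series (ml_term 0 n.+1 i (p' * (beta * t) ^+ n.+1))))%:E)%E.
Proof.
move=> th0 p'; set x := expR (- theta).
have x0 : 0 < x by exact: expR_gt0.
have x1 : x <= 1 by rewrite expR_le1 oppr_le0.
have d0 : 0 < lambda + lambda1 * (1 - x).
  by rewrite ltr_pwDl// mulr_ge0 ?subr_ge0// ltW.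
have p'0 : 0 <= p' by rewrite divr_ge0// ltW.
have qx1 : q * x < 1.
  by rewrite (@le_lt_trans _ _ q)// ?ler_piMr ?(ltW q0)// qE ltrBlDr ltrDl.
have qx0 : 0 <= q * x by rewrite mulr_ge0// ltW.
have pp' : p' = p / (1 - q * x).
  rewrite /p' /p /q -/x; field.
  by rewrite !gt_eqF//=; lra.
have mexp : measurable_fun setT (fun w => (expR (- theta * (Z t w)%:R))%:E).
  apply: (@measurableT_comp _ _ _ _ _ _ (fun k : nat => (expR (- theta * k%:R))%:E)) => //.
  move=> _ B _; rewrite setTI (_ : _ @^-1` _ = \bigcup_(k in B) [set w | Z t w = k]).
    by apply: bigcup_measurable => k _; exact: measurable_time_changed_event.
  by apply/seteqP; split => w /= => [Bw|[k Bk ->]//]; exists (Z t w).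
rewrite (integral_partition P measurable_time_changed_event) => [||w]; last 2 first.
- exact: mexp.
- by rewrite lee_fin expR_ge0.
transitivity (\sum_(k <oo) \sum_(j <oo)
  (a j * p ^+ j.+1 * ('C(k + j, j)%:R * (q * x) ^+ k))%:E)%E.
  apply: eq_eseriesr => k _.
  transitivity ((x ^+ k)%:E * P [set w | Z t w = k])%E.
    rewrite -integral_cst; last exact: measurable_time_changed_event.
    apply: eq_integral => w; rewrite inE/= => ->.
    by rewrite -expRM_natr.
  rewrite -Z_pmf_series -nneseriesZl; last first.
    by move=> j _; rewrite lee_fin !mulr_ge0// exprn_ge0// ltW.
  apply: eq_eseriesr => j _; rewrite -EFinM; congr EFin.
  (* Symmetry of the binomial coefficient makes [k] the summation index and [j] the fixed one, as
     [negative_binomial_cvg] expects. *)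
  rewrite -bin_sub ?leq_addl// addnK (addnC j) [(q * x) ^+ k]exprMn; ring.
rewrite nneseries_interchange; last first.
  by move=> i j; rewrite lee_fin !mulr_ge0// exprn_ge0// ltW.
transitivity (\sum_(j <oo) (a j * ('C(j + 0, 0)%:R * p' ^+ j.+1))%:E)%E.
  apply: eq_eseriesr => j _.
  under eq_eseriesr do rewrite EFinM.
  rewrite nneseriesZl; last first.
    by move=> k _; rewrite lee_fin !mulr_ge0// exprn_ge0// ltW.
  rewrite (_ : \sum_(k <oo) _ = ((1 - q * x)^-1 ^+ j.+1)%:E)%E; last first.
    apply/nneseries_cvg => [k|]; first by rewrite mulr_ge0// exprn_ge0.
    exact: negative_binomial_cvg.
  by rewrite -EFinM bin0 mul1r pp' [(p / _) ^+ _]exprMn mulrA.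
apply/nneseries_cvg => [j|]; first by rewrite !mulr_ge0// exprn_ge0.
exact: ml_sum_cvg.
Qed.

End time_changed_process.

(* The published mass function carries an additional factor (k + 1).  It is an
   erratum: at t = 0 those values would add up to (lambda1 + lambda) / lambda,
   which exceeds 1, and they contradict the Laplace transform below. *)
Theorem theorem9 (R : realType) (d : measure_display) (T : measurableType d)
    (P : probability T R) (n : nat) (lambda lambda1 beta : R)
    (N : R -> {RV P >-> nat}) (G : nat -> {RV P >-> R})
    (N1 : R -> {RV P >-> nat})
    (n_ge1 : (1 <= n)%N) (lambda_gt0 : 0 < lambda) (lambda1_gt0 : 0 < lambda1)
    (beta_gt0 : 0 < beta)
    (G_N_cpe : compound_poisson_erlang P lambda n beta N G)
    (N1_poisson : poisson_process P lambda1 N1) :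
  let Y := inverse_process (compound_sum N G) in
  let Z := time_changed N1 Y in
  independent_systems P (sigma_of nonneg_times (fun s => N1 s : T -> nat))
    (sigma_of nonneg_times (fun s => Y s : T -> \bar R)) ->
  forall t : R, 0 <= t ->
  (forall k : nat,
    P [set w | Z t w = k] =
    (expR (- beta * t)
     * (lambda * lambda1 ^+ k / (lambda1 + lambda) ^+ k.+1)
     * \sum_(1 <= m < n.+1)
         (beta * t) ^+ m.-1
         * mittag_leffler3 k.+1%:R n%:R m%:R
             (lambda * (beta * t) ^+ n / (lambda1 + lambda)))%:E)
  /\
  (forall theta : R, 0 <= theta ->
    ('E_P[fun w => expR (- theta * (Z t w)%:R)] =
     (expR (- beta * t)
      * (lambda / (lambda + lambda1 * (1 - expR (- theta))))
      * \sum_(1 <= k < n.+1)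
          (beta * t) ^+ k.-1
          * mittag_leffler n%:R k%:R
              (lambda * (beta * t) ^+ n
               / (lambda + lambda1 * (1 - expR (- theta)))))%:E)%E).
Proof.
case: n n_ge1 G_N_cpe => [//|n'] _ NG Y Z N1Y t t0.
split=> [k|theta theta0].
  rewrite (time_changed_pmf lambda_gt0 lambda1_gt0 beta_gt0 NG N1_poisson N1Y t0).
  congr EFin; rewrite mulNr big_add1 big_mkord /=; congr (_ * _ * _).
    rewrite expr_div_n exprS; field.
    by rewrite expf_neq0 gt_eqF// addr_gt0.
  apply: eq_bigr => i _; rewrite mittag_leffler3E; congr (_ * limn (series (ml_term _ _ _ _))).
  by rewrite mulrAC.
rewrite unlock.
rewrite (time_changed_laplace lambda_gt0 lambda1_gt0 beta_gt0 NG N1_poisson N1Y t0 theta0).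
congr EFin; rewrite mulNr big_add1 big_mkord /=; congr (_ * _).
apply: eq_bigr => i _; rewrite mittag_lefflerE; congr (_ * limn (series (ml_term _ _ _ _))).
by rewrite mulrAC.
Qed.
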